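(* Let $d\ge1$, let $V\subset\mathbb{Z}^d$ be a finite nonempty set, let $\lambda,\kappa\ge0$, $\gamma>0$, let $p$ be a probability distribution on $\mathbb{Z}^d$ with $p(z)=p(-z)$ and $\sum_{z}e^{\langle\alpha,z\rangle}p(z)<\infty$ for all $\alpha\in\mathbb{R}^d$, and let $\pi(v,v')\ge0$ ($v,v'\in V$) be transition rates of an irreducible continuous-time Markov chain on $V$. Let $\{(X_t,v_t):t\ge0\}$ be the Markov process on $\mathbb{Z}^d\times V$ with generator $L$ given in the context, started from $X_0=0$ and an arbitrary initial velocity distribution on $V$. Let $A$, $\Gamma$, $\psi_\alpha$, $M(\alpha)$, $I_A$ be as in the context, and let $\mathcal{P}(V)$ be the set of probability measures on $V$. Then for every $\alpha\in\mathbb{R}^d$ the limit $$F(\alpha)=\lim_{t\to\infty}\frac1t\log\mathbb{E}\left(e^{\langle\alpha,X_t\rangle}\right)$$ exists and: (i) $F(\alpha)$ is the largest eigenvalue of the matrix $M(\alpha)$ (i.e. $F(\alpha)$ is an eigenvalue of $M(\alpha)$ and every eigenvalue of $M(\alpha)$ has real part at most $F(\alpha)$); (ii) $$F(\alpha)=\sup_{\mu\in\mathcal{P}(V)}\left(\sum_{v\in V}\psi_\alpha(v)\mu(v)-\gamma I_A(\mu)\right)=\kappa\Gamma(\alpha)+\sup_{\mu\in\mathcal{P}(V)}\left(\sum_{v\in V}\lambda\left(e^{\langle\alpha,v\rangle}-1\right)\mu(v)-\gamma I_A(\mu)\right);$$ (iii) in the symmetric case, $\pi(v,v')=\pi(v',v)$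 for all $v,v'\in V$, $$F(\alpha)=\sup_{\mu\in\mathcal{P}(V)}\left(\sum_{v\in V}\psi_\alpha(v)\mu(v)+\gamma\sum_{v,v'\in V}\sqrt{\mu(v)}\sqrt{\mu(v')}\,A_{v,v'}\right).$$ As a consequence, $X_t/t$ satisfies the large deviation principle (as $t\to\infty$, with speed $t$) on $\mathbb{R}^d$ with rate function $I(x)=\sup_{\alpha\in\mathbb{R}^d}\left(\langle\alpha,x\rangle-F(\alpha)\right)$.
   Context: $\langle\cdot,\cdot\rangle$ is the Euclidean inner product on $\mathbb{R}^d$. The generator is $L=\lambda L_t+\kappa L_d+\gamma L_f$ with $$L_tf(x,v)=f(x+v,v)-f(x,v),\qquad L_df(x,v)=\sum_{z\in\mathbb{Z}^d}p(z)\big(f(x+z,v)-f(x,v)\big),$$ $$L_ff(x,v)=\sum_{v'\in V}\pi(v,v')\big(f(x,v')-f(x,v)\big).$$ The velocity flip process is the Markov chain on $V$ with generator $Af(v)=\sum_{v'\in V}\pi(v,v')(f(v')-f(v))$, whose matrix is $A_{v,v'}=\pi(v,v')$ for $v\ne v'$ and $A_{v,v}=-\sum_{v'\ne v}\pi(v,v')$. Its Donsker–Varadhan occupation-time rate function is $$I_A(\mu)=-\inf_{f:V\to(0,\infty)}\sum_{v\in V}\frac{Af(v)}{f(v)}\,\mu(v),\qquad\mu\in\mathcal{P}(V).$$ Further, $\Gamma(\alpha)=\sum_{z}p(z)\left(e^{\langle\alpha,z\rangle}-1\right)$ and $\psi_\alpha(v)=\kappa\Gamma(\alpha)+\lambda\left(e^{\langle\alpha,v\rangle}-1\right)$.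 $M(\alpha)$ is the real $V\times V$ matrix with diagonal entries $M(\alpha)_{v,v}=\psi_\alpha(v)+\gamma A_{v,v}$ and off-diagonal entries $M(\alpha)_{v,v'}=\gamma\pi(v',v)$; it is the matrix such that $\mathcal{F}(t,\alpha,v)=\sum_x\mathbb{P}(X_t=x,v_t=v)e^{\langle\alpha,x\rangle}$ satisfies $\frac{d}{dt}\mathcal{F}(t,\alpha,\cdot)=M(\alpha)\mathcal{F}(t,\alpha,\cdot)$. The large deviation principle with speed $t$ and rate function $I$ means: $\limsup_{t\to\infty}\frac1t\log\mathbb{P}(X_t/t\in B)\le-\inf_{B}I$ for closed $B\subset\mathbb{R}^d$ and $\liminf_{t\to\infty}\frac1t\log\mathbb{P}(X_t/t\in G)\ge-\inf_GI$ for open $G\subset\mathbb{R}^d$. *)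

(* Defs.v *)
From HB Require Import structures.
From mathcomp Require Export all_boot all_order all_algebra.
From mathcomp Require Export finmap.
From mathcomp Require Export all_classical all_reals all_analysis.
From mathcomp Require Import complex.

Set Implicit Arguments.
Unset Strict Implicit.
Unset Printing Implicit Defensive.
Import Order.TTheory GRing.Theory Num.Theory.
Import numFieldNormedType.Exports.
Local Open Scope classical_set_scope.
Local Open Scope ring_scope.

Section Sums.
Context {R : realType} {S : choiceType}.

(* [esum] is only meaningful for nonnegative terms, so an absolutely convergent
   sum of real terms is the difference of the sums of the positive and of the
   negative parts. *)
Definition rsum (f : S -> R) : R :=
  fine (\esum_(x in [set: S]) (Num.max (f x) 0)%:E
        - \esum_(x in [set: S]) (Num.max (- f x) 0)%:E)%E.

Definition prob_mass (p : S -> R) : Prop :=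
  (forall x, 0 <= p x) /\ (\esum_(x in [set: S]) (p x)%:E = 1)%E.

End Sums.

Section MarkovProcesses.
Context {R : realType} {S : choiceType}.

Definition transition_function (Q : R -> S -> S -> R) : Prop :=
  [/\ forall t x, 0 <= t -> prob_mass (Q t x),
      forall x y, Q 0 x y = (x == y)%:R
    & forall s t x y, 0 <= s -> 0 <= t ->
        ((Q (s + t) x y)%:E = \esum_(z in [set: S]) (Q s x z * Q t z y)%:E)%E].

Definition bounded_fct (f : S -> R) : Prop := exists C, forall x, `|f x| <= C.

Definition semigroup (Q : R -> S -> S -> R) (t : R) (f : S -> R) (x : S) : R :=
  rsum (fun y => Q t x y * f y).

(* The infinitesimal generator of the semigroup on the bounded functions with the
   sup norm, for an operator [G] defined on all bounded functions: the difference
   quotient tends to [G f] uniformly on [S]. *)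
Definition has_generator (Q : R -> S -> S -> R) (G : (S -> R) -> S -> R) : Prop :=
  forall f, bounded_fct f -> forall e : R, 0 < e ->
    \forall t \near 0^'+, forall x,
      `|t^-1 * (semigroup Q t f x - f x) - G f x| < e.

Context {dO : measure_display} {Omega : measurableType dO}.

(* [S] is countable in all uses and carries the discrete sigma-algebra. The list
   [h] fixes the states at finitely many times up to [s]. Only the values [Y t] with
   [0 <= t] are constrained. *)
Definition markov_process (P : probability Omega R) (Y : R -> Omega -> S)
    (Q : R -> S -> S -> R) : Prop :=
  (forall t, 0 <= t -> forall A : set S, measurable (Y t @^-1` A)) /\
  (forall (h : seq (R * S)) (s t : R) (x y : S),
    (forall u, u \in h -> 0 <= u.1 <= s) -> 0 <= s -> s <= t ->
    let past := [set w | Y s w = x /\ forall u, u \in h -> Y u.1 w = u.2] in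
    (P (past `&` [set w | Y t w = y]) = P past * (Q (t - s) x y)%:E)%E).

Definition markov_process_with_generator (P : probability Omega R)
    (Y : R -> Omega -> S) (G : (S -> R) -> S -> R) : Prop :=
  exists Q, [/\ transition_function Q, has_generator Q G & markov_process P Y Q].

End MarkovProcesses.

Section FiniteChain.
Context {R : realType} {V : finType}.
Implicit Types (pi : V -> V -> R) (mu f : V -> R).

Definition irreducible_rates pi : Prop :=
  forall v v', connect [rel a b | 0 < pi a b] v v'.

Definition flip_generator pi f (v : V) : R :=
  \sum_(v' : V) pi v v' * (f v' - f v).

Definition flip_rate pi (v v' : V) : R :=
  if v == v' then - \sum_(w : V | w != v) pi v w else pi v v'.

Definition prob_measures : set (V -> R) :=
  [set mu | (forall v, 0 <= mu v) /\ \sum_(v : V) mu v = 1].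

Definition DV_rate pi mu : \bar R :=
  (- ereal_inf [set (\sum_(v : V) flip_generator pi f v / f v * mu v)%:E
               | f in [set f : V -> R | forall v, 0 < f v]%R])%E.

End FiniteChain.

Section ActiveParticle.
Context {R : realType} {d : nat} {V : {fset 'rV[int]_d}}.
Implicit Types (p : 'rV[int]_d -> R) (pi : V -> V -> R) (alpha : 'rV[R]_d).

Definition dot (n : nat) (a b : 'rV[R]_n) : R := \sum_(i < n) a 0 i * b 0 i.

Definition real_vec (n : nat) (z : 'rV[int]_n) : 'rV[R]_n := map_mx intr z.

Local Notation state := ('rV[int]_d * V)%type.

Definition Lt (f : state -> R) (x : state) : R :=
  f (x.1 + val x.2, x.2) - f x.

Definition Ld p (f : state -> R) (x : state) : R :=
  rsum (fun z => p z * (f (x.1 + z, x.2) - f x)).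

Definition Lf pi (f : state -> R) (x : state) : R :=
  \sum_(v' : V) pi x.2 v' * (f (x.1, v') - f x).

Definition generatorL (lambda kappa gamma : R) p pi
    (f : state -> R) (x : state) : R :=
  lambda * Lt f x + kappa * Ld p f x + gamma * Lf pi f x.

Definition Gamma p alpha : R :=
  rsum (fun z => p z * (expR (dot alpha (real_vec z)) - 1)).

Definition psi (lambda kappa : R) p alpha (v : V) : R :=
  kappa * Gamma p alpha + lambda * (expR (dot alpha (real_vec (val v))) - 1).

(* Rows and columns are indexed by the enumeration of [V]; note the transposition
   of the rates. *)
Definition Mmatrix (lambda kappa gamma : R) p pi alpha : 'M[R]_#|{: V}| :=
  \matrix_(i, j)
    let v := enum_val i in let v' := enum_val j in
    if v == v' then psi lambda kappa p alpha v + gamma * flip_rate pi v v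
    else gamma * pi v' v.

End ActiveParticle.

(* [eigenvalue] is about row eigenvectors, which does not change the spectrum. *)
Definition largest_eigenvalue {R : realType} (n : nat) (A : 'M[R]_n) (a : R) : Prop :=
  eigenvalue A a /\
  forall z : R[i],
    eigenvalue (map_mx (real_complex R) A) z -> complex.Re z <= a.

Definition LDP {R : realType} (n : nat) {dO : measure_display}
    {Omega : measurableType dO} (P : probability Omega R)
    (Z : R -> Omega -> 'rV[R]_n) (I : 'rV[R]_n -> \bar R) : Prop :=
  (forall B : set 'rV[R]_n, closed B ->
    (limf_esup (fun t : R => t^-1%:E * lne (P [set w | B (Z t w)])) (pinfty_nbhs R)
     <= - ereal_inf (I @` B))%E) /\
  (forall G : set 'rV[R]_n, open G ->
    (- ereal_inf (I @` G) <=
     limf_einf (fun t : R => t^-1%:E * lne (P [set w | G (Z t w)])) (pinfty_nbhs R))%E).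

Definition legendre {R : realType} (n : nat) (F : 'rV[R]_n -> R) (x : 'rV[R]_n) : \bar R :=
  ereal_sup [set (dot alpha x - F alpha)%:E | alpha in [set: 'rV[R]_n]].

(* Main.v *)
Require Import Defs.
From mathcomp Require Import measurable_realfun ring lra complex.

(** Let [k] be the operator [fk_kernel gamma pi psi_alpha] on functions of the
    velocity.  It is irreducible with nonnegative off-diagonal entries, so it has
    positive right and left eigenvectors [r], [l] for a common eigenvalue
    [F alpha] ([perron_frobenius], by maximising the Collatz-Wielandt ratio on a
    compact set).  Everything is read off these eigenvectors.

    Finite-dimensional formulas.  The weights [l v * k v v' * r v'] have both
    marginals proportional to the probability [l r].  Convexity of [- ln] under
    these weights shows that [l r] attains the Donsker-Varadhan supremum, while
    [r] is a test function bounding it ([perron_DV]); convexity of the square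
    gives the Rayleigh formula and the bound on the real parts of complex
    eigenvalues ([perron_rayleigh], [perron_spectral_bound]).

    Exponential moments.  The function [f (x, v) = expR (dot alpha x) * r v]
    satisfies [L f = F f], but it is unbounded whereas the semigroup is known
    through its generator on bounded functions only.  The truncation
    [f_N = min f N] satisfies [|L f_N - F f_N| <= (C / N) * f_N ^ 2], and
    [f_N ^ 2] is a Lyapunov function: [L (f_N ^ 2) <= c * f_N ^ 2].  A discrete
    variation-of-constants argument ([semigroup_approx_eigen]) propagates this,
    and [N] tending to infinity gives [E f (X_t, v_t)] of order [expR (F t)].
    Since [r] is bounded above and below, [E expR (dot alpha X_t)] lies between
    two constant multiples of [expR (F t)] ([mgf_bounds]), which is stronger than
    the existence of the logarithmic limit.

    Large deviations.  For the upper bound, a closed set on which the rate exceeds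
    [m] is covered by finitely many half-spaces [dot a x - F a > m], to each of
    which the exponential Chebyshev inequality applies
    ([finite_halfspace_cover], [ldp_upper]).  For the lower bound, [F] is
    differentiable: its value perturbs like a simple eigenvalue
    ([perron_expansion], [root_quad_expansion]).  Around a gradient of [F] the
    tilted measure concentrates ([tilted_lower_bound]).  Instead of convex duality
    on the effective domain of the rate function, a point [x] of finite rate is
    replaced by a gradient close to [x] whose rate is no larger, obtained by
    maximising [dot a x - F a - eps / 2 * dot a a] ([gradient_approx]). *)

Set Implicit Arguments.
Unset Strict Implicit.
Unset Printing Implicit Defensive.
Import Order.TTheory GRing.Theory Num.Theory.
Import numFieldNormedType.Exports.
Local Open Scope classical_set_scope.
Local Open Scope ring_scope.

(** * Perron eigenvectors of irreducible matrices *)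

Section Perron.
Context {R : realType}.

Lemma psumr_gt0 (I : finType) (F : I -> R) (i0 : I) :
  (forall i, 0 <= F i) -> 0 < F i0 -> 0 < \sum_i F i.
Proof.
move=> F0 Fi0; rewrite (bigD1 i0)//= ltr_pwDl//.
by apply: sumr_ge0 => i _; exact: F0.
Qed.

(** Paths of positive entries give positive powers, and the positive diagonal lets
    one exponent serve all pairs. *)
Lemma exprmx_gt0 n (B : 'M[R]_n.+1) :
  (forall i j, 0 <= B i j) -> (forall i, 0 < B i i) ->
  (forall i j, connect [rel a b | 0 < B a b] i j) ->
  exists k, forall i j, 0 < (B ^+ k) i j.
Proof.
move=> B0 Bd irr.
have Bk0 k i j : 0 <= (B ^+ k) i j.
  elim: k i j => [|k IH] i j; first by rewrite expr0 mxE ler0n.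
  by rewrite exprSr mxE; apply: sumr_ge0 => l _; exact: mulr_ge0.
have BkD k m i j : 0 < (B ^+ k) i j -> 0 < (B ^+ (k + m)) i j.
  move=> Bkij; elim: m => [|m IH]; first by rewrite addn0.
  rewrite addnS exprSr mxE; apply: (@psumr_gt0 _ _ j) => [l|]; first exact: mulr_ge0.
  exact: mulr_gt0.
have ex i j : exists k, 0 < (B ^+ k) i j.
  have /connectP[s + ->] := irr i j; elim: s i => [|a s IH] i /=.
    by exists 0%N; rewrite expr0 mxE eqxx ltr01.
  move=> /andP[ia /IH[k hk]]; exists k.+1; rewrite exprS mxE.
  apply: (@psumr_gt0 _ _ a) => [l|]; first exact: mulr_ge0.
  exact: mulr_gt0.
have [K hK] := choice (fun ij : 'I_n.+1 * 'I_n.+1 => ex ij.1 ij.2).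
exists (\max_ij K ij) => i j.
have le : (K (i, j) <= \max_ij K ij)%N by exact: leq_bigmax.
by rewrite -(subnKC le); apply: BkD; exact: hK.
Qed.

(** The shift makes the diagonal positive without changing the eigenvectors. *)
Lemma shift_pos_power n (A : 'M[R]_n.+1) :
  (forall i j, i != j -> 0 <= A i j) ->
  (forall i j, connect [rel a b | 0 < A a b] i j) ->
  exists c k, forall i j, 0 < ((A + c%:M) ^+ k) i j.
Proof.
move=> A0 irr; pose c := 1 + \sum_i `|A i i|.
have le i : `|A i i| <= \sum_i `|A i i|.
  by rewrite (bigD1 i)//= lerDl sumr_ge0.
have Bd i : 0 < (A + c%:M) i i.
  rewrite !mxE eqxx mulr1n /c; have := le i; have := ler_norm (- A i i).
  rewrite normrN; lra.
have [] := @exprmx_gt0 n (A + c%:M) _ Bd.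
- move=> i j; have [->|ij] := eqVneq i j; first exact: ltW.
  by rewrite !mxE (negbTE ij) mulr0n addr0 A0.
- move=> i j; apply: (connect_sub _ (irr i j)) => a b /= ab.
  have [<-|nab] := eqVneq a b; first exact: connect0.
  by apply: connect1; rewrite /= !mxE (negbTE nab) mulr0n addr0.
by move=> k hk; exists c, k.
Qed.

Lemma mulmx_pos_gt0 n (T : 'M[R]_n.+1) (u : 'rV[R]_n.+1) :
  (forall i j, 0 < T i j) -> (forall i, 0 <= u 0 i) -> u != 0 ->
  forall i, 0 < (u *m T) 0 i.
Proof.
move=> T0 u0 un0 i.
have [j uj] : exists j, u 0 j != 0.
  apply: contrapT => /forallNP h; case/eqP: un0; apply/rowP => j; rewrite mxE.
  by apply/eqP/negPn/negP; exact: h.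
rewrite mxE; apply: (@psumr_gt0 _ _ j) => [l|].
  by apply: mulr_ge0; [exact: u0|exact/ltW/T0].
by rewrite mulr_gt0// lt_neqAle eq_sym uj u0.
Qed.

Lemma continuous_sum (T : topologicalType) (I : Type) (s : seq I)
   (f : I -> T -> R) (x : T) :
  (forall i, f i y @[y --> x] --> f i x) ->
  \sum_(i <- s) f i y @[y --> x] --> \sum_(i <- s) f i x.
Proof.
move=> c; elim: s => [|a s IH].
  by under eq_fun do rewrite big_nil; rewrite big_nil; exact: cvg_cst.
under eq_fun do rewrite big_cons; rewrite big_cons.
by apply: cvgD; [exact: c|exact: IH].
Qed.

Lemma continuous_mulmx_coord m n (T : 'M[R]_(m, n)) i :
  continuous (fun y : 'rV[R]_m => (y *m T) 0 i).
Proof.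
move=> y; rewrite /continuous_at mxE; under eq_fun do rewrite mxE; 
apply: (@continuous_sum _ _ _ (fun j (z : 'rV[R]_m) => z 0 j * T j i)) => j.
exact: (cvgM (@coord_continuous R 1 m 0 j y) (cvg_cst (T j i))).
Qed.

Lemma continuous_bigmin (T : topologicalType) (I : Type) (s : seq I)
   (f0 : T -> R) (f : I -> T -> R) (x : T) :
  f0 y @[y --> x] --> f0 x -> (forall i, f i y @[y --> x] --> f i x) ->
  \big[Order.min/f0 y]_(i <- s) f i y @[y --> x] -->
    \big[Order.min/f0 x]_(i <- s) f i x.
Proof.
move=> c0 c; elim: s => [|a s IH].
  by under eq_fun do rewrite big_nil; rewrite big_nil.
under eq_fun do rewrite big_cons; rewrite big_cons.
exact: (@continuous_min R T (f a) _ x (c a) IH).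
Qed.

(** Collatz-Wielandt: a row vector [x] maximising the least ratio
    [(x A)_i / x_i] is an eigenvector, since otherwise multiplying it by a
    positive matrix commuting with [A] would increase every ratio.  The maximum
    is taken over the image of the simplex under that matrix, where the ratios
    are continuous. *)
Lemma perron_row n (A : 'M[R]_n.+1) :
  (forall i j, i != j -> 0 <= A i j) ->
  (forall i j, connect [rel a b | 0 < A a b] i j) ->
  exists rho (x : 'rV[R]_n.+1), (forall i, 0 < x 0 i) /\ x *m A = rho *: x.
Proof.
move=> A0 irr; have [c [k]] := shift_pos_power A0 irr.
set T := _ ^+ k => T0.
have TA : T *m A = A *m T.
  apply: commr_sym; apply: commrX; apply: commrD; first exact: commr_refl.
  exact: comm_mx_scalar.
pose simplex := [set y : 'rV[R]_n.+1 | (forall i, 0 <= y 0 i) /\ \sum_i y 0 i = 1].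
pose ratio i (y : 'rV[R]_n.+1) := (y *m (T *m A)) 0 i / (y *m T) 0 i.
pose g y := \big[Order.min/ratio ord0 y]_(i < n.+1) ratio i y.
have nz y : simplex y -> y != 0.
  move=> [_ y1]; apply/eqP => y0; move: y1; rewrite y0 big1; last first.
    by move=> i _; rewrite mxE.
  by move/eqP; rewrite eq_sym oner_eq0.
have [y0 /set_mem sy0 ymax] : exists2 y, y \in simplex &
    forall z, z \in simplex -> g z <= g y.
  apply: compact_EVT_max.
  - exists (\row_j (j == ord0)%:R); split => [i|]; first by rewrite mxE.
    rewrite (bigD1 ord0)//= mxE eqxx big1 ?addr0// => i /negbTE i0.
    by rewrite mxE i0.
  - apply: (@subclosed_compact _ _
      [set v : 'rV[R]_n.+1 | forall i, `[0, 1]%classic (v ord0 i)]).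
    + have -> : simplex = (\bigcap_i [set y : 'rV[R]_n.+1 | 0 <= y 0 i]) `&`
          [set y : 'rV[R]_n.+1 | \sum_i y 0 i = 1].
        by by apply/seteqP; split => y [h1 h2]; split => // i; [move=> _|]; apply: h1.
      apply: closedI.
        apply: closed_bigI => i _.
        apply: (@preimage_closed _ _ (fun y : 'rV[R]_n.+1 => y 0 i) [set x | 0 <= x]).
          by move=> y _; apply: coord_continuous.
        exact: closed_ge.
      apply: (@preimage_closed _ _ (fun y : 'rV[R]_n.+1 => \sum_i y 0 i) [set 1]).
        move=> y _.
        apply: (@continuous_sum _ _ _ (fun i (z : 'rV[R]_n.+1) => z 0 i)) => i.
        by apply: coord_continuous.
      exact: closed_eq.
    + apply: (@rV_compact R n.+1 (fun=> `[0, 1]%classic)) => i.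
      exact: segment_compact.
    + move=> y [y0 y1] i /=; rewrite in_itv/= y0/= -y1 (bigD1 i)//= lerDl.
      exact: sumr_ge0.
  - apply: continuous_in_subspaceT => y /set_mem sy.
    have cr i : ratio i z @[z --> y] --> ratio i y.
      have nz0 : (y *m T) 0 i != 0.
        by rewrite gt_eqF//; apply: mulmx_pos_gt0 => //; [exact: sy.1|exact: nz].
      exact: (cvgM (@continuous_mulmx_coord _ _ (T *m A) i y)
                   (cvgV nz0 (@continuous_mulmx_coord _ _ T i y))).
    exact: continuous_bigmin.
set x := y0 *m T; set rho := g y0.
have x0 i : 0 < x 0 i.
  by apply: mulmx_pos_gt0 => //; [exact: sy0.1|exact: nz].
have grho i : rho <= ratio i y0.
  exact: bigmin_le.
exists rho, x; split => //; apply/eqP; rewrite -subr_eq0; apply/negPn/negP => dn0.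
have d0 i : 0 <= (x *m A - rho *: x) 0 i.
  rewrite [X in _ <= X]mxE [X in _ + X]mxE [X in _ - X]mxE subr_ge0.
  by rewrite -ler_pdivlMr// -mulmxA; exact: grho.
have Td i := mulmx_pos_gt0 T0 d0 dn0 i.
pose s := \sum_i x 0 i.
have s0 : 0 < s by apply: (@psumr_gt0 _ _ ord0) => // i; exact: ltW.
have sx : simplex (s^-1 *: x).
  split=> [i|]; first by rewrite mxE mulr_ge0 ?invr_ge0 ?ltW.
  under eq_bigr do rewrite mxE.
  by rewrite -mulr_sumr mulVf ?gt_eqF.
have : g (s^-1 *: x) <= rho by apply: ymax; exact/mem_set.
apply/negP; rewrite -ltNge.
have Tx i : 0 < (x *m T) 0 i.
  apply: mulmx_pos_gt0 => // [j|]; first exact/ltW/x0.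
  by apply/eqP => xe; have := x0 ord0; rewrite xe mxE ltxx.
have key i : rho < ratio i (s^-1 *: x).
  have sc (z : 'rV[R]_n.+1) : (s^-1 *: z) 0 i = s^-1 * z 0 i by rewrite mxE.
  rewrite /ratio -!scalemxAl !sc ltr_pdivlMr; last by rewrite mulr_gt0 ?invr_gt0.
  rewrite mulrCA ltr_pM2l ?invr_gt0//.
  have := Td i; rewrite mulmxBl -scalemxAl -(mulmxA x A) -TA.
  by rewrite mxE [X in _ + X]mxE [X in _ - X]mxE subr_gt0.
by rewrite /g; elim/big_rec : _ => // i z _ hz; rewrite lt_min key.
Qed.

(** A power of the shifted matrix spreads any positive entry to all the others. *)
Lemma ge0_eigen_eq0 n (A : 'M[R]_n.+1) rho (u : 'rV[R]_n.+1) i0 :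
  (forall i j, i != j -> 0 <= A i j) ->
  (forall i j, connect [rel a b | 0 < A a b] i j) ->
  u *m A = rho *: u -> (forall i, 0 <= u 0 i) -> u 0 i0 = 0 -> u = 0.
Proof.
move=> A0 irr uA u0 ui0; have [c [k T0]] := shift_pos_power A0 irr.
apply/eqP/negPn/negP => un0.
have := mulmx_pos_gt0 T0 u0 un0 i0.
suff -> : u *m (A + c%:M) ^+ k = (rho + c) ^+ k *: u by rewrite mxE ui0 mulr0 ltxx.
elim: {T0} k => [|k IH]; first by rewrite !expr0 mulmx1 scale1r.
rewrite exprSr mulmxA IH -scalemxAl mulmxDr uA mul_mx_scalar -scalerDl scalerA.
by rewrite -exprSr.
Qed.

End Perron.

(** * Perron triples of kernels on a finite set *)

Section PerronKernel.
Context {R : realType} {V : finType}.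
Implicit Types (k : V -> V -> R) (l r : V -> R).

Lemma sum1_inhabited (f : V -> R) : \sum_v f v = 1 -> exists v0 : V, True.
Proof.
move=> f1; apply: contrapT => /forallNP h; move: f1; rewrite big1 => [/esym/eqP|v].
  by rewrite oner_eq0.
by have := h v.
Qed.

(** The diagonal is unconstrained, as for the sum of the generator of a Markov
    chain and of a potential. *)
Definition metzler k : Prop :=
  (forall v v', v != v' -> 0 <= k v v') /\
  (forall v v', connect [rel a b | 0 < k a b] v v').

Definition perron_triple k (rho : R) l r : Prop :=
  [/\ forall v, 0 < l v, forall v, 0 < r v,
      forall v, \sum_v' k v v' * r v' = rho * r v,
      forall v', \sum_v l v * k v v' = rho * l v' & \sum_v l v * r v = 1].

Lemma metzlerC k : metzler k -> metzler (fun v v' => k v' v).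
Proof.
move=> [k0 irr]; split=> [v v' vv'|v v']; first by rewrite k0// eq_sym.
by have := connect_rev [rel a b | 0 < k a b] v v'; rewrite /= => ->; exact: irr.
Qed.

Lemma card_ordS_bij (v0 : V) : exists n (f : 'I_n.+1 -> V) (g : V -> 'I_n.+1),
  cancel f g /\ cancel g f.
Proof.
have : (0 < #|V|)%N by apply/card_gt0P; exists v0.
case E : #|V| => [//|n] _; exists n, (fun i => enum_val (cast_ord (esym E) i)).
exists (fun v => cast_ord E (enum_rank v)).
split=> x; first by rewrite enum_valK cast_ordKV.
by rewrite cast_ordK enum_rankK.
Qed.

Lemma reindex_bij n (f : 'I_n -> V) (g : V -> 'I_n) (F : V -> R) :
  cancel f g -> cancel g f -> \sum_v F v = \sum_i F (f i).
Proof. by move=> fK gK; rewrite (reindex f)//; exists g => x _. Qed.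

Definition kernel_mx n (f : 'I_n -> V) k : 'M[R]_n := \matrix_(i, j) k (f i) (f j).

Lemma kernel_mx_metzler n (f : 'I_n -> V) g k : cancel f g -> cancel g f ->
  metzler k ->
  (forall i j, i != j -> 0 <= kernel_mx f k i j) /\
  (forall i j, connect [rel a b | 0 < kernel_mx f k a b] i j).
Proof.
move=> fK gK [k0 irr]; split=> [i j ij|i j].
  by rewrite mxE k0// (inj_eq (can_inj fK)).
have /connectP[s] := irr (f i) (f j).
elim: s i => [|a s IH] i /=; first by move=> _ /(can_inj fK) ->.
move=> /andP[ia sa jE]; apply: (@connect_trans _ _ (g a)).
  by apply: connect1; rewrite /= mxE gK.
by apply: IH; rewrite gK.
Qed.

Lemma kernel_right_perron k (v0 : V) : metzler k ->
  exists rho r, (forall v, 0 < r v) /\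
    forall v, \sum_v' k v v' * r v' = rho * r v.
Proof.
move=> /metzlerC mk; have [n [f [g [fK gK]]]] := card_ordS_bij v0.
have [k0 irr] := kernel_mx_metzler fK gK mk.
have [rho [x [x0 xE]]] := perron_row k0 irr.
exists rho, (fun v => x 0 (g v)); split=> // v.
have /rowP/(_ (g v)) := xE; rewrite !mxE => <-.
rewrite (reindex_bij _ fK gK); apply: eq_bigr => i _.
by rewrite mxE gK fK mulrC.
Qed.

(** The left eigenvector comes from the transposed kernel; pairing it with the
    right one shows that the two eigenvalues coincide. *)
Lemma perron_frobenius k (v0 : V) : metzler k ->
  exists rho l r, perron_triple k rho l r.
Proof.
move=> mk; have [rho [r [r0 rE]]] := kernel_right_perron v0 mk.
have [rho' [l [l0 lE]]] := kernel_right_perron v0 (metzlerC mk).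
pose s := \sum_v l v * r v.
have s0 : 0 < s by apply: (@psumr_gt0 _ _ _ v0) => [v|]; [apply/ltW|]; exact: mulr_gt0.
have eqrho : rho' = rho.
  have sn0 : s != 0 by rewrite gt_eqF.
  apply: (mulIf sn0); rewrite /s !mulr_sumr.
  transitivity (\sum_v \sum_w k w v * l w * r v).
    by apply: eq_bigr => v _; rewrite mulrA -lE mulr_suml.
  rewrite exchange_big; apply: eq_bigr => w _; rewrite mulrCA -rE mulr_sumr.
  by apply: eq_bigr => v _ /=; ring.
exists rho, (fun v => s^-1 * l v), r; split=> // [v|v'|].
- by rewrite mulr_gt0 ?invr_gt0.
- under eq_bigr do rewrite -mulrA; rewrite -mulr_sumr mulrCA; congr (_ * _).
  by rewrite -eqrho -lE; apply: eq_bigr => v _; rewrite mulrC.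
- by under eq_bigr do rewrite -mulrA; rewrite -mulr_sumr mulVf ?gt_eqF.
Qed.

(** Once a Perron eigenvector is known, the eigenspace is a line and the shifted
    operator is invertible on the complement of the dual eigenvector, so an
    approximate eigenvector is close to an exact one. *)
Lemma perron_stability k rho l r : metzler k -> perron_triple k rho l r ->
  exists2 C, 0 <= C & forall w b, \sum_v l v * w v = 0 ->
    (forall v, `|\sum_v' k v v' * w v' - rho * w v| <= b) ->
    forall v, `|w v| <= C * b.
Proof.
move=> mk [l0 r0 rE lE lr].
have [v0 _] := sum1_inhabited lr.
have [n [f [g [fK gK]]]] := card_ordS_bij v0.
have [B0 irr] := kernel_mx_metzler fK gK (metzlerC mk).
set B := kernel_mx _ _ in B0 irr.
pose lc : 'cV[R]_n.+1 := \col_i l (f i).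
pose rr : 'rV[R]_n.+1 := \row_i r (f i).
have rB : rr *m B = rho *: rr.
  apply/rowP => j; rewrite !mxE -rE (reindex_bij _ fK gK).
  by apply: eq_bigr => i _; rewrite !mxE mulrC.
have Bl : B *m lc = rho *: lc.
  apply/colP => i; rewrite !mxE -lE (reindex_bij _ fK gK).
  by apply: eq_bigr => j _; rewrite !mxE mulrC.
have rl : rr *m lc = 1%:M.
  apply/matrixP => i j; rewrite !ord1 !mxE eqxx -lr (reindex_bij _ fK gK).
  by apply: eq_bigr => a _; rewrite !mxE mulrC.
(* The rank-one term acts as the identity on the eigenline and vanishes on the
   complement, where [w] lives. *)
pose U := B - rho%:M + lc *m rr.
have Uunit : U \in unitmx.
  rewrite -row_free_unit -kermx_eq0; apply/eqP/row_matrixP => i; rewrite row0.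
  set W := row i _.
  have WU : W *m U = 0 by apply/sub_kermxP/row_sub.
  have Wl : W *m lc = 0.
    have := congr1 (fun z => z *m lc) WU; rewrite mul0mx /U.
    rewrite mulmxDr mulmxDl mulmxBr mulmxBl -!mulmxA Bl rl mulmx1.
    by rewrite mul_scalar_mx subrr add0r.
  have WB : W *m B = rho *: W.
    move: WU; rewrite /U mulmxDr mulmxA Wl mul0mx addr0 mulmxBr mul_mx_scalar.
    by move/eqP; rewrite subr_eq0 => /eqP.
  (* The least multiple of [rr] above [W] touches it, so the difference is a
     nonnegative eigenvector with a zero entry. *)
  pose i0 := [arg max_(a > ord0) (W 0 a / rr 0 a)]%O.
  pose t := W 0 i0 / rr 0 i0.
  have rr0 a : 0 < rr 0 a by rewrite mxE.
  have tr : t *: rr - W = 0.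
    apply: (@ge0_eigen_eq0 _ _ B rho _ i0) => //.
    - by rewrite mulmxBl -scalemxAl rB WB scalerBr !scalerA mulrC.
    - move=> a; rewrite mxE [X in X + _]mxE [X in _ + X]mxE subr_ge0.
      rewrite -ler_pdivrMr// /t /i0.
      by case: Order.TotalTheory.arg_maxP => // b _; apply.
    - rewrite mxE [X in X + _]mxE [X in _ + X]mxE /t mulfVK ?subrr//.
      by rewrite gt_eqF.
  move/eqP: tr; rewrite subr_eq0 => /eqP tr.
  move: Wl; rewrite -tr -scalemxAl rl => /matrixP/(_ 0 0).
  by rewrite !mxE eqxx mulr1 => ->; rewrite scale0r.
pose C := \sum_i \sum_j `|invmx U i j|.
exists C; first by do 2!apply: sumr_ge0 => ? _.
move=> w b lw wb v.
pose W : 'rV[R]_n.+1 := \row_i w (f i).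
have WUE : W *m U = W *m B - rho *: W.
  rewrite /U mulmxDr mulmxA (_ : W *m lc = 0) ?mul0mx ?addr0 ?mulmxBr ?mul_mx_scalar//.
  apply/matrixP => i j; rewrite !ord1 [RHS]mxE -[RHS]lw mxE (reindex_bij _ fK gK).
  by apply: eq_bigr => a _; rewrite !mxE mulrC.
have WUb j : `|(W *m U) 0 j| <= b.
  apply: le_trans (wb (f j)); rewrite WUE !mxE (reindex_bij _ fK gK).
  by rewrite (eq_bigr (fun i => k (f j) (f i) * w (f i)))// => i _; rewrite !mxE mulrC.
have b0 : 0 <= b by apply: le_trans (wb v).
have -> : w v = (W *m U *m invmx U) 0 (g v) by rewrite mulmxK// mxE gK.
rewrite mxE (le_trans (ler_norm_sum _ _ _))// /C mulrC mulr_sumr.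
apply: ler_sum => i _; rewrite normrM; apply: ler_pM => //.
by rewrite (bigD1 (g v))//= lerDl sumr_ge0.
Qed.

(** Pairing the perturbed eigenvector equation with the unperturbed left
    eigenvector gives [rho - rho0 = sum l D r] exactly, with [sum l r = 1]; by
    stability, replacing [r] by [r0] costs one more factor [delta]. *)
Lemma perron_expansion k rho0 l r0 : metzler k -> perron_triple k rho0 l r0 ->
  exists2 C, 0 <= C & forall (D : V -> R) delta rho l' r,
    (forall v, `|D v| <= delta) ->
    perron_triple (fun v v' => k v v' + (v == v')%:R * D v) rho l' r ->
    `|rho - rho0 - \sum_v l v * D v * r0 v| <= C * delta ^+ 2.
Proof.
move=> mk pt; have [C C0 hC] := perron_stability mk pt.
case: pt => l0 r00 r0E lE lr0.
pose L := \sum_v l v; pose B := \sum_v (l v)^-1.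
have L0 : 0 <= L by apply: sumr_ge0 => v _; exact: ltW.
have B0 : 0 <= B by apply: sumr_ge0 => v _; rewrite invr_ge0 ltW.
exists (L * (C * (2 * B))); first by rewrite !mulr_ge0.
move=> D delta rho l' r1 Dd [_ r10 r1E _ _].
pose s := \sum_v l v * r1 v.
pose r v := s^-1 * r1 v.
have [v0 _] := sum1_inhabited lr0.
have d0 : 0 <= delta by apply: le_trans (Dd v0).
have s0 : 0 < s by apply: (@psumr_gt0 _ _ _ v0) => [v|]; [apply/ltW|]; exact: mulr_gt0.
have r_0 v : 0 < r v by rewrite mulr_gt0 ?invr_gt0.
have lr : \sum_v l v * r v = 1.
  by under eq_bigr do rewrite mulrCA; rewrite -mulr_sumr mulVf ?gt_eqF.
have rE v : \sum_v' k v v' * r v' = (rho - D v) * r v.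
  rewrite mulrBl /r [rho * _]mulrCA -r1E mulr_sumr -(addrK (D v * r v) (\sum_v' _)).
  congr (_ - _); rewrite (bigD1 v)//= [in RHS](bigD1 v)//= eqxx mul1r.
  rewrite addrAC (eq_bigr (fun v' => s^-1 * ((k v v' + (v == v')%:R * D v) * r1 v'))).
    by rewrite /r; congr (_ + _); ring.
  by move=> v' /negbTE v'v; rewrite eq_sym v'v mul0r addr0 /r mulrCA.
clearbody r.
have lrhoE : rho - rho0 = \sum_v l v * D v * r v.
  have h : \sum_v l v * \sum_v' k v v' * r v' = rho0.
    under eq_bigr do rewrite mulr_sumr; rewrite exchange_big/=.
    under eq_bigr => v _.
      rewrite (eq_bigr (fun w => l w * k w v * r v)); last by move=> w _; rewrite mulrA.
      by rewrite -mulr_suml lE -mulrA over.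
    by rewrite -mulr_sumr lr mulr1.
  rewrite -h -(mulr1 rho) -lr mulr_sumr -sumrB; apply: eq_bigr => v _.
  by rewrite rE; ring.
have rhod : `|rho - rho0| <= delta.
  rewrite lrhoE (le_trans (ler_norm_sum _ _ _))// -(mulr1 delta) -lr mulr_sumr.
  apply: ler_sum => v _; rewrite !normrM (gtr0_norm (l0 v)) (gtr0_norm (r_0 v)).
  by rewrite mulrAC mulrC ler_wpM2r// mulr_ge0// ltW.
have rB v : r v <= B.
  have h : l v * r v <= 1.
    by rewrite -lr (bigD1 v)//= lerDl sumr_ge0// => w _; rewrite mulr_ge0// ltW.
  apply: (@le_trans _ _ (l v)^-1); first by rewrite -[(l v)^-1]mulr1 ler_pdivlMl.
  by rewrite /B (bigD1 v)//= lerDl sumr_ge0// => w _; rewrite invr_ge0 ltW.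
have rr0 v : `|r v - r0 v| <= C * (2 * B * delta).
  apply: (hC (fun v => r v - r0 v)) => [|{}v].
    by under eq_bigr do rewrite mulrBr; rewrite sumrB lr lr0 subrr.
  under eq_bigr do rewrite mulrBr; rewrite sumrB rE r0E.
  have -> : (rho - D v) * r v - rho0 * r0 v - rho0 * (r v - r0 v)
     = (rho - rho0 - D v) * r v by ring.
  rewrite normrM (gtr0_norm (r_0 v)) mulrAC; apply: ler_pM => //; first exact: ltW.
  by rewrite (le_trans (ler_normB _ _))// mulr_natl mulr2n lerD.
rewrite lrhoE -sumrB (le_trans (ler_norm_sum _ _ _))// -!mulrA mulr_suml.
apply: ler_sum => v _; rewrite -mulrBr normrM normrM (gtr0_norm (l0 v)) -mulrA.
rewrite ler_pM2l//; apply: (le_trans (ler_pM _ _ (Dd v) (rr0 v))) => //.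
by rewrite le_eqVlt; apply/orP; left; apply/eqP; ring.
Qed.

End PerronKernel.

(** * Donsker-Varadhan formula, Rayleigh quotient and spectral bound *)

Section FeynmanKac.
Context {R : realType} {V : finType}.
Implicit Types (k pi : V -> V -> R) (l r phi f mu : V -> R).

(** The Feynman-Kac operator acting on functions; the matrix of the theorem, which
    acts on measures, is its transpose. *)
Definition fk_kernel (gamma : R) pi phi (v v' : V) : R :=
  gamma * flip_rate pi v v' + (v == v')%:R * phi v.

Lemma sum_flip_rate pi f v : \sum_v' flip_rate pi v v' * f v' = flip_generator pi f v.
Proof.
rewrite /flip_generator (bigD1 v)//= [RHS](bigD1 v)//= subrr mulr0 add0r.
rewrite /flip_rate eqxx mulNr mulr_suml -sumrN -big_split/=.
by apply: eq_bigr => w wv; rewrite eq_sym (negbTE wv); ring.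
Qed.

Lemma fk_kernel_sum gamma pi phi f v :
  \sum_v' fk_kernel gamma pi phi v v' * f v' =
  gamma * flip_generator pi f v + phi v * f v.
Proof.
under eq_bigr do rewrite mulrDl; rewrite big_split/=; congr (_ + _).
  by under eq_bigr do rewrite -mulrA; rewrite -mulr_sumr sum_flip_rate.
rewrite (bigD1 v)//= eqxx mul1r big1 ?addr0// => w wv.
by rewrite eq_sym (negbTE wv) !mul0r.
Qed.

Lemma fk_kernel_metzler gamma pi phi : 0 < gamma ->
  (forall v v', 0 <= pi v v') -> irreducible_rates pi ->
  metzler (fk_kernel gamma pi phi).
Proof.
move=> g0 pi0 irr; split=> [v v' vv'|v v'].
  by rewrite /fk_kernel /flip_rate (negbTE vv') mul0r addr0 mulr_ge0// ltW.
apply: (connect_sub _ (irr v v')) => a b /= ab.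
have [<-|nab] := eqVneq a b; first exact: connect0.
apply: connect1.
by rewrite /= /fk_kernel /flip_rate (negbTE nab) mul0r addr0 mulr_gt0.
Qed.

Lemma fk_kernelD gamma pi phi D : fk_kernel gamma pi (fun v => phi v + D v) =
  (fun v v' => fk_kernel gamma pi phi v v' + (v == v')%:R * D v).
Proof. by apply/funext => v; apply/funext => v'; rewrite /fk_kernel mulrDr addrA. Qed.

(** With [f = r g], the weights [l v * k v v' * r v'] have marginals
    proportional to [l r], so [x - 1 >= ln x] applied to the off-diagonal ratios
    [g v' / g v] leaves a telescoping sum. *)
Lemma perron_ratio_ge k rho l r f : metzler k -> perron_triple k rho l r ->
  (forall v, 0 < f v) ->
  rho <= \sum_v (\sum_v' k v v' * f v') / f v * (l v * r v).
Proof.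
move=> [k0 _] [l0 r0 rE lE lr] f0.
pose w v v' := l v * k v v' * r v'.
pose h v := ln (f v / r v).
have wr v : \sum_v' w v v' = rho * (l v * r v).
  by rewrite /w; under eq_bigr do rewrite -mulrA; rewrite -mulr_sumr rE mulrCA.
have wl v' : \sum_v w v v' = rho * (l v' * r v').
  by rewrite /w -mulr_suml lE mulrA.
have E : \sum_v \sum_v' w v v' * (1 + (h v' - h v)) = rho.
  under eq_bigr do under eq_bigr do rewrite mulrDr mulrBr mulr1.
  under eq_bigr do rewrite big_split/= sumrB -mulr_suml.
  rewrite big_split/= sumrB exchange_big/=.
  under [X in X + (_ - _)]eq_bigr do rewrite wl.
  rewrite -mulr_sumr lr mulr1 [X in _ + (X - _)]exchange_big/=.
  rewrite -sumrB big1 ?addr0// => v _.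
  by rewrite -mulr_suml wl wr subrr.
rewrite -[leLHS]E; apply: ler_sum => v _.
rewrite -mulrA [_^-1 * _]mulrC mulrA !mulr_suml; apply: ler_sum => v' _.
have -> : k v v' * f v' * (l v * r v) / f v = w v v' * ((f v' / r v') / (f v / r v)).
  by rewrite /w; field; rewrite !gt_eqF.
have [<-|vv'] := eqVneq v v'.
  by rewrite subrr addr0 mulr1 mulfV ?mulr1// gt_eqF// divr_gt0.
apply: ler_wpM2l; first by rewrite /w !mulr_ge0 ?k0// ltW.
rewrite /h -ln_div ?posrE ?divr_gt0//.
set x := _ / _; have x0 : 0 < x by rewrite !divr_gt0.
have := @le_ln1Dx R (x - 1); rewrite [1 + (x - 1)]addrC subrK => /(_ _).
by lra.
Qed.

(** The same weights as above, with [x y <= (x^2 + y^2) / 2] in place of the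
    logarithm. *)
Lemma perron_quadratic_le k rho l r u : metzler k ->
  (forall v, 0 < l v) -> (forall v, 0 < r v) ->
  (forall v, \sum_v' k v v' * r v' = rho * r v) ->
  (forall v', \sum_v l v * k v v' = rho * l v') ->
  \sum_v l v / r v * u v * (\sum_v' k v v' * u v') <=
  rho * \sum_v l v / r v * u v ^+ 2.
Proof.
move=> [k0 _] l0 r0 rE lE.
pose w v v' := l v * k v v' * r v'; pose g v := u v / r v.
have -> : rho * \sum_v l v / r v * u v ^+ 2 =
    \sum_v \sum_v' w v v' * ((g v ^+ 2 + g v' ^+ 2) / 2).
  transitivity (\sum_v \sum_v' w v v' * (g v ^+ 2 / 2) +
                \sum_v \sum_v' w v v' * (g v' ^+ 2 / 2)).
    have wr v : \sum_v' w v v' = rho * (l v * r v).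
      by rewrite /w; under eq_bigr do rewrite -mulrA; rewrite -mulr_sumr rE mulrCA.
    have wl v' : \sum_v w v v' = rho * (l v' * r v') by rewrite /w -mulr_suml lE mulrA.
    rewrite [X in _ = _ + X]exchange_big/=.
    under [X in _ = X + _]eq_bigr do rewrite -mulr_suml wr.
    under [X in _ = _ + X]eq_bigr do rewrite -mulr_suml wl.
    rewrite -big_split/= mulr_sumr; apply: eq_bigr => v _.
    by rewrite /g; field; rewrite gt_eqF.
  rewrite -big_split; apply: eq_bigr => v _; rewrite -big_split; apply: eq_bigr => v' _ /=.
  by field.
apply: ler_sum => v _; rewrite mulr_sumr; apply: ler_sum => v' _.
have -> : l v / r v * u v * (k v v' * u v') = w v v' * (g v * g v').
  by rewrite /w /g; field; rewrite !gt_eqF.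
have [<-|vv'] := eqVneq v v'.
  by rewrite le_eqVlt; apply/orP; left; apply/eqP; field.
apply: ler_wpM2l; first by rewrite /w !mulr_ge0 ?k0// ltW.
by have := sqr_ge0 (g v - g v'); rewrite sqrrB; lra.
Qed.

(** Donsker-Varadhan: the eigenvector [r] is a test function for the upper bound
    and [l r] the maximising measure. *)
Lemma perron_DV gamma pi phi rho l r : 0 < gamma ->
  (forall v v', 0 <= pi v v') -> irreducible_rates pi ->
  perron_triple (fk_kernel gamma pi phi) rho l r ->
  rho%:E = ereal_sup [set ((\sum_(u : V) phi u * mu u)%R%:E
                             - gamma%:E * DV_rate pi mu)%E
                       | mu in prob_measures].
Proof.
move=> g0 pi0 irr pt; have mk := fk_kernel_metzler phi g0 pi0 irr.
have [l0 r0 rE lE lr] := pt.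
have genE f v : 0 < f v -> gamma * (flip_generator pi f v / f v) =
    (\sum_v' fk_kernel gamma pi phi v v' * f v') / f v - phi v.
  by move=> fv; rewrite fk_kernel_sum; field; rewrite gt_eqF.
have DVE mu : (- (gamma%:E * DV_rate pi mu) = gamma%:E * ereal_inf
   [set (\sum_(v : V) flip_generator pi f v / f v * mu v)%:E
               | f in [set f : V -> R | forall v, 0 < f v]%R])%E.
  by rewrite /DV_rate muleN oppeK.
apply/eqP; rewrite eq_le; apply/andP; split.
- rewrite -[leLHS](_ : (\sum_v phi v * (l v * r v) +
       gamma * ((rho - \sum_v phi v * (l v * r v)) / gamma))%:E = _)%E; last first.
    by congr (_%:E); field; rewrite gt_eqF.
  pose m v := l v * r v.
  pose y : \bar R := ((\sum_(u : V) phi u * m u)%:E - gamma%:E * DV_rate pi m)%E.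
  apply: (@le_trans _ (\bar R) y); last first.
    apply: ereal_sup_ubound; exists m => //.
    by split=> // v; rewrite mulr_ge0// ltW.
  rewrite /y DVE EFinD leeD2l// EFinM lee_wpmul2l ?lee_fin ?(ltW g0)//.
  apply: le_ereal_inf_tmp => _ [f f0 <-]; rewrite lee_fin ler_pdivrMr// mulr_suml.
  under [leRHS]eq_bigr do rewrite mulrC mulrA genE// mulrBl.
  rewrite sumrB lerD2r; exact: (perron_ratio_ge mk pt f0).
- apply: ge_ereal_sup => _ [mu [mu0 mu1] <-]; rewrite DVE.
  pose y : \bar R := ((\sum_(u : V) phi u * mu u)%:E + gamma%:E *
     (\sum_(v : V) flip_generator pi r v / r v * mu v)%:E)%E.
  apply: (@le_trans _ (\bar R) y).
    rewrite leeD2l// lee_wpmul2l ?lee_fin ?(ltW g0)//.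
    by apply: ereal_inf_lbound; exists r.
  rewrite /y -EFinM -EFinD lee_fin mulr_sumr -big_split/=.
  rewrite (eq_bigr (fun v => rho * mu v)); first by rewrite -mulr_sumr mu1 mulr1.
  by move=> v _; rewrite mulrA genE// rE mulfK ?gt_eqF//; ring.
Qed.

(** In the symmetric case [r] is also a left eigenvector, and the supremum is the
    Rayleigh quotient written with [u = sqrt mu]. *)
Lemma perron_rayleigh gamma pi phi rho l r : 0 < gamma ->
  (forall v v', 0 <= pi v v') -> irreducible_rates pi ->
  (forall v v', pi v v' = pi v' v) ->
  perron_triple (fk_kernel gamma pi phi) rho l r ->
  rho%:E = ereal_sup [set (\sum_(u : V) phi u * mu u
                             + gamma * \sum_(u : V) \sum_(u' : V)
                                 Num.sqrt (mu u) * Num.sqrt (mu u')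
                                 * flip_rate pi u u')%:E
                       | mu in prob_measures].
Proof.
move=> g0 pi0 irr sym pt; have mk := fk_kernel_metzler phi g0 pi0 irr.
have [l0 r0 rE lE lr] := pt.
have rE' v' : \sum_v r v * fk_kernel gamma pi phi v v' = rho * r v'.
  rewrite -rE; apply: eq_bigr => v _; rewrite mulrC /fk_kernel /flip_rate eq_sym.
  by case: eqVneq => [->//|_]; rewrite sym !mul0r.
have formE mu : (forall v, 0 <= mu v) -> \sum_(u : V) phi u * mu u
     + gamma * \sum_(u : V) \sum_(u' : V)
         Num.sqrt (mu u) * Num.sqrt (mu u') * flip_rate pi u u' =
     \sum_v r v / r v * Num.sqrt (mu v) *
        \sum_v' fk_kernel gamma pi phi v v' * Num.sqrt (mu v').
  move=> mu0; rewrite mulr_sumr -big_split/=; apply: eq_bigr => v _.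
  rewrite fk_kernel_sum -sum_flip_rate divff ?gt_eqF// mul1r mulrDr addrC.
  congr (_ + _); last by rewrite mulrCA -expr2 sqr_sqrtr.
  by rewrite [RHS]mulrCA; congr (_ * _); rewrite mulr_sumr; apply: eq_bigr => w _; ring.
apply/eqP; rewrite eq_le; apply/andP; split.
- pose s := \sum_v r v ^+ 2.
  have [v0 _] := sum1_inhabited lr.
  have s0 : 0 < s.
    by apply: (@psumr_gt0 _ _ _ v0) => [v|]; [exact: sqr_ge0|rewrite exprn_gt0].
  pose mu v := r v ^+ 2 / s.
  have mu0 v : 0 <= mu v by rewrite divr_ge0 ?sqr_ge0// ltW.
  have muE v : Num.sqrt (mu v) = r v / Num.sqrt s.
    rewrite /mu sqrtrM ?sqr_ge0// sqrtrV ?(ltW s0)// sqrtr_sqr gtr0_norm//.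
  apply: ereal_sup_ubound; exists mu.
    by split=> //; rewrite /mu -mulr_suml mulfV ?gt_eqF.
  congr (_%:E); rewrite formE//.
  rewrite (eq_bigr (fun v => rho * mu v)) => [|v _].
    by rewrite -mulr_sumr /mu -mulr_suml mulfV ?gt_eqF ?mulr1.
  under eq_bigr do rewrite muE mulrA; rewrite -mulr_suml rE muE divff ?gt_eqF//.
  rewrite /mu -[in RHS](sqr_sqrtr (ltW s0)); field.
  by rewrite gt_eqF// sqrtr_gt0.
- apply: ge_ereal_sup => _ [mu [mu0 mu1] <-]; rewrite lee_fin formE//.
  apply: le_trans (perron_quadratic_le _ mk r0 r0 rE rE') _.
  rewrite (eq_bigr mu) ?mu1 ?mulr1// => v _.
  by rewrite divff ?gt_eqF// mul1r sqr_sqrtr.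
Qed.

(** The real part [x] of a complex eigenvalue is a weighted average of the Rayleigh
    quotients of the real part [a] and the imaginary part [b] of an eigenvector. *)
Lemma perron_spectral_bound k rho l r (a b : V -> R) (x y : R) : metzler k ->
  perron_triple k rho l r ->
  (forall v, \sum_v' k v v' * a v' = x * a v - y * b v) ->
  (forall v, \sum_v' k v v' * b v' = x * b v + y * a v) ->
  (exists v, (a v != 0) || (b v != 0)) -> x <= rho.
Proof.
move=> mk [l0 r0 rE lE lr] aE bE [v0 abv0].
have := lerD (perron_quadratic_le a mk l0 r0 rE lE) (perron_quadratic_le b mk l0 r0 rE lE).
rewrite -mulrDr -!big_split/=.
set S := (X in _ <= rho * X).
have S0 : 0 < S.
  apply: (@psumr_gt0 _ _ _ v0) => [v|].
    by rewrite -mulrDr mulr_ge0 ?addr_ge0 ?sqr_ge0// divr_ge0// ltW.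
  rewrite -mulrDr mulr_gt0 ?divr_gt0// lt_neqAle addr_ge0 ?sqr_ge0// andbT.
  by rewrite eq_sym paddr_eq0 ?sqr_ge0// !sqrf_eq0 negb_and.
rewrite (eq_bigr (fun v => x * (l v / r v * a v ^+ 2 + l v / r v * b v ^+ 2))).
  by rewrite -mulr_sumr ler_pM2r.
by move=> v _; rewrite aE bE; ring.
Qed.

End FeynmanKac.

(** * Sums of real families and Markov semigroups on bounded functions *)

Section RealSums.
Context {R : realType} {S : choiceType}.
Implicit Types (f g a b : S -> R).

Lemma esumZ_le (c : R) (a : S -> \bar R) : 0 <= c -> (forall x, 0 <= a x)%E ->
  (\esum_(x in [set: S]) (c%:E * a x) <= c%:E * \esum_(x in [set: S]) a x)%E.
Proof.
move=> c0 a0; apply: ge_ereal_sup => _ [A [fA _] <-].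
rewrite -ge0_mule_fsumr; last by move=> x; exact: a0.
rewrite lee_wpmul2l ?lee_fin//; apply: ereal_sup_ubound; exists A => //.
Qed.

Lemma esumZ (c : R) (a : S -> \bar R) : 0 <= c -> (forall x, 0 <= a x)%E ->
  (\esum_(x in [set: S]) (c%:E * a x) = c%:E * \esum_(x in [set: S]) a x)%E.
Proof.
move=> c0 a0; apply/eqP; rewrite eq_le esumZ_le//=.
have [->|cn0] := eqVneq c 0; first by rewrite mul0e esum_ge0// => x _; rewrite mul0e.
have cp : 0 < c by rewrite lt_neqAle eq_sym cn0.
rewrite -lee_pdivlMl//.
apply: le_trans (esumZ_le _ _); rewrite ?invr_ge0//; last first.
  by move=> x; rewrite mule_ge0.
apply: le_esum => x _; rewrite muleA -EFinM mulVf// mul1e//.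
Qed.

Lemma esumZr (c : R) a : 0 <= c -> (forall x, 0 <= a x) ->
  (\esum_(x in [set: S]) (c * a x)%:E = c%:E * \esum_(x in [set: S]) (a x)%:E)%E.
Proof. by move=> c0 a0; under eq_esum do rewrite EFinM; rewrite esumZ. Qed.

Lemma esum_exchange (T : choiceType) (a : S -> T -> \bar R) :
  (forall x y, 0 <= a x y)%E ->
  (\esum_(x in [set: S]) \esum_(y in [set: T]) a x y =
   \esum_(y in [set: T]) \esum_(x in [set: S]) a x y)%E.
Proof.
move=> a0; rewrite !esum_esum//.
rewrite (@reindex_esum R (T * S)%type (S * T)%type ([set: T] `*`` fun=> [set: S])
   ([set: S] `*`` fun=> [set: T]) (fun p => (p.2, p.1)))//.
split => [[x y] //|[x y] [x' y'] _ _ [-> ->] //|[x y] _]; exists (y, x) => //.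
Qed.

Definition rsummable f : Prop := (\esum_(x in [set: S]) `|f x|%:E < +oo)%E.

Lemma rsummable_le f g : (forall x, `|f x| <= g x) ->
  (\esum_(x in [set: S]) (g x)%:E < +oo)%E -> rsummable f.
Proof. by move=> fg; apply: le_lt_trans; apply: le_esum => x _; rewrite lee_fin. Qed.

(** Any decomposition into summable nonnegative parts computes [rsum], not only the
    canonical one; linearity rests on this freedom. *)
Lemma rsumE a b : (forall x, 0 <= a x) -> (forall x, 0 <= b x) ->
  (\esum_(x in [set: S]) (a x)%:E < +oo)%E ->
  (\esum_(x in [set: S]) (b x)%:E < +oo)%E ->
  rsum (fun x => a x - b x) = fine (\esum_(x in [set: S]) (a x)%:E)
                            - fine (\esum_(x in [set: S]) (b x)%:E).
Proof.
move=> a0 b0 sa sb; rewrite /rsum.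
have fa : (\esum_(x in [set: S]) (a x)%:E)%E \is a fin_num.
  by rewrite ge0_fin_numE// esum_ge0// => x _; rewrite lee_fin.
have fb : (\esum_(x in [set: S]) (b x)%:E)%E \is a fin_num.
  by rewrite ge0_fin_numE// esum_ge0// => x _; rewrite lee_fin.
rewrite -fineB//; congr fine.
rewrite -(@esumB _ _ [set: S] (fun x => (a x)%:E) (fun x => (b x)%:E)).
- congr (_ - _)%E; apply: eq_esum => x _; symmetry.
    by rewrite funeposE -EFin_max.
  by rewrite funenegE -EFin_max opprB.
- by rewrite /summable; under eq_esum do rewrite abse_EFin ger0_norm//.
- by rewrite /summable; under eq_esum do rewrite abse_EFin ger0_norm//.
- by move=> x _; rewrite lee_fin.
- by move=> x _; rewrite lee_fin.
Qed.


Lemma rsum_ge0E f : (forall x, 0 <= f x) ->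
  (\esum_(x in [set: S]) (f x)%:E < +oo)%E ->
  (rsum f)%:E = \esum_(x in [set: S]) (f x)%:E.
Proof.
move=> f0 sf; rewrite -[f](_ : (fun x => f x - 0) = f); last first.
  by apply/funext => x; rewrite subr0.
rewrite rsumE//; last by rewrite esum1.
rewrite [fine (\esum_(_ in _) 0%:E)](_ : _ = 0) ?subr0; last by rewrite esum1.
under [RHS]eq_esum do rewrite subr0.
by rewrite fineK// ge0_fin_numE// esum_ge0// => x _; rewrite lee_fin.
Qed.

Lemma esum_fin_num a : (forall x, 0 <= a x) ->
  (\esum_(x in [set: S]) (a x)%:E < +oo)%E ->
  (\esum_(x in [set: S]) (a x)%:E)%E \is a fin_num.
Proof. by move=> a0 sa; rewrite ge0_fin_numE// esum_ge0// => x _; rewrite lee_fin. Qed.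

Lemma rsummable_decomp f : rsummable f -> exists a b,
  [/\ forall x, 0 <= a x, forall x, 0 <= b x,
      (\esum_(x in [set: S]) (a x)%:E < +oo)%E,
      (\esum_(x in [set: S]) (b x)%:E < +oo)%E & f = (fun x => a x - b x)].
Proof.
move=> sf; exists (fun x => Num.max (f x) 0), (fun x => Num.max (- f x) 0); split.
- by move=> x; rewrite le_max lexx orbT.
- by move=> x; rewrite le_max lexx orbT.
- apply: le_lt_trans sf; apply: le_esum => x _.
  by rewrite lee_fin ge_max normr_ge0 ler_norm.
- apply: le_lt_trans sf; apply: le_esum => x _.
  by rewrite lee_fin ge_max normr_ge0 -normrN ler_norm.
- by apply/funext => x; case: (leP (f x) 0) => h; case: (leP (- f x) 0) => h'; lra.
Qed.

Lemma rsumD f g : rsummable f -> rsummable g ->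
  rsum (fun x => f x + g x) = rsum f + rsum g.
Proof.
move=> /rsummable_decomp[a [b [a0 b0 sa sb ->]]] /rsummable_decomp[c [e [c0 e0 sc se ->]]].
have E (u v : S -> R) : (forall x, 0 <= u x) -> (forall x, 0 <= v x) ->
    (\esum_(x in [set: S]) (u x + v x)%:E = \esum_(x in [set: S]) (u x)%:E
      + \esum_(x in [set: S]) (v x)%:E)%E.
  by move=> u0 v0; rewrite -esumD// => x _; rewrite lee_fin.
rewrite (_ : (fun x => _) = (fun x => (a x + c x) - (b x + e x))); last first.
  by apply/funext => x; ring.
rewrite !rsumE//.
- by rewrite !E// !fineD ?esum_fin_num//; ring.
- by move=> x; exact: addr_ge0.
- by move=> x; exact: addr_ge0.
- by rewrite E// lte_add_pinfty.
- by rewrite E// lte_add_pinfty.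
Qed.

Lemma rsumN f : rsummable f -> rsum (fun x => - f x) = - rsum f.
Proof.
move=> /rsummable_decomp[a [b [a0 b0 sa sb ->]]].
rewrite (_ : (fun x => - _) = (fun x => b x - a x)) ?rsumE//; last first.
  by apply/funext => x; ring.
by ring.
Qed.

Lemma rsummableZ c f : rsummable f -> rsummable (fun x => c * f x).
Proof.
move=> sf; rewrite /rsummable; under eq_esum do rewrite normrM EFinM.
rewrite esumZ ?normr_ge0//.
by rewrite lte_mul_pinfty// lee_fin.
Qed.

Lemma rsummableN f : rsummable f -> rsummable (fun x => - f x).
Proof. by rewrite /rsummable; under [X in _ -> (X < _)%E]eq_esum do rewrite normrN. Qed.

Lemma rsummableD f g : rsummable f -> rsummable g -> rsummable (fun x => f x + g x).
Proof.
move=> sf sg; apply: (@le_lt_trans _ _ (\esum_(x in [set: S]) (`|f x|%:E + `|g x|%:E))%E).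
  by apply: le_esum => x _; rewrite -EFinD lee_fin ler_normD.
rewrite esumD ?lte_add_pinfty// => x _; rewrite lee_fin//.
Qed.

Lemma rsumZ c f : rsummable f -> rsum (fun x => c * f x) = c * rsum f.
Proof.
have pos e h : 0 <= e -> rsummable h -> rsum (fun x => e * h x) = e * rsum h.
  move=> e0 /rsummable_decomp[a [b [a0 b0 sa sb ->]]].
  have E (u : S -> R) : (forall x, 0 <= u x) ->
      (\esum_(x in [set: S]) (e * u x)%:E = e%:E * \esum_(x in [set: S]) (u x)%:E)%E.
    by move=> u0; under eq_esum do rewrite EFinM; rewrite esumZ.
  rewrite (_ : (fun x => _ * _) = (fun x => e * a x - e * b x)); last first.
    by apply/funext => x; ring.
  rewrite !rsumE//.
  - by rewrite !E// !fineM ?esum_fin_num//= mulrBr.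
  - by move=> x; exact: mulr_ge0.
  - by move=> x; exact: mulr_ge0.
  - by rewrite E// lte_mul_pinfty// lee_fin.
  - by rewrite E// lte_mul_pinfty// lee_fin.
move=> sf; have [c0|c0] := leP 0 c; first exact: pos.
rewrite (_ : (fun x => c * f x) = (fun x => - ((- c) * f x))); last first.
  by apply/funext => x; ring.
by rewrite rsumN ?pos ?mulNr ?opprK ?oppr_ge0 ?(ltW c0)//; exact: rsummableZ.
Qed.

Lemma rsum_ge0 f : (forall x, 0 <= f x) -> 0 <= rsum f.
Proof.
move=> f0; rewrite /rsum fine_ge0// [X in (_ - X)%E]esum1 ?sube0.
  by apply: esum_ge0 => x _; rewrite lee_fin le_max lexx orbT.
by move=> x _; congr (_%:E); apply/max_idPr; rewrite oppr_le0.
Qed.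

Lemma ler_rsum f g : rsummable f -> rsummable g -> (forall x, f x <= g x) ->
  rsum f <= rsum g.
Proof.
move=> sf sg fg; rewrite -subr_ge0 -rsumN// -rsumD//; last exact: rsummableN.
by apply: rsum_ge0 => x; rewrite subr_ge0.
Qed.

Lemma ler_norm_rsum f g : (forall x, `|f x| <= g x) ->
  (\esum_(x in [set: S]) (g x)%:E < +oo)%E -> `|rsum f| <= rsum g.
Proof.
move=> fg sg.
have sf : rsummable f by exact: rsummable_le sg.
have g0 x : 0 <= g x by apply: le_trans (fg x).
have sg' : rsummable g by apply: rsummable_le sg => x; rewrite ger0_norm.
rewrite ler_norml; apply/andP; split.
  rewrite lerNl -rsumN//; apply: ler_rsum => // [|x]; first exact: rsummableN.
  by rewrite lerNl; have := fg x; rewrite ler_norml => /andP[].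
by apply: ler_rsum => // x; apply: le_trans (fg x); rewrite ler_norm.
Qed.

Section ProbMass.
Variable q : S -> R.
Hypothesis qP : prob_mass q.

Lemma prob_mass_rsummable f C : (forall x, `|f x| <= C) ->
  rsummable (fun x => q x * f x).
Proof.
have [q0 q1] := qP => fC.
apply: (@rsummable_le _ (fun x => `|C| * q x)) => [x|].
  by rewrite normrM ger0_norm// mulrC ler_wpM2r// (le_trans (fC x))// ler_norm.
by rewrite esumZr// q1 mule1 ltry.
Qed.

Lemma prob_mass_avg_cst c : rsum (fun x => q x * c) = c.
Proof.
have [q0 q1] := qP; have sq : rsummable q.
  by rewrite /rsummable; under eq_esum do rewrite ger0_norm//; rewrite q1 ltry.
rewrite (_ : (fun x => _) = (fun x => c * q x)); last first.
  by apply/funext => x; rewrite mulrC.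
rewrite rsumZ// -[RHS]mulr1; congr (_ * _).
by apply: EFin_inj; rewrite rsum_ge0E// q1 ltry.
Qed.

End ProbMass.

End RealSums.

Section Exponential.
Context {R : realType}.

Lemma expR_remainder (u : R) :
  `|expR u - 1 - u| <= u ^+ 2 * expR `|u|.
Proof.
have h1 := expR_ge1Dx u; have h2 := expR_ge1Dx (- u).
have e0 := expR_gt0 u; have E : expR u * expR (- u) = 1 by rewrite -expRD subrr expR0.
have h3 : expR u - 1 <= u * expR u.
  have : expR u * (1 - u) <= 1 by rewrite -[leRHS]E ler_wpM2l// ltW.
  lra.
rewrite ger0_norm; last by lra.
have [u0|u0] := leP 0 u.
  rewrite ger0_norm//; apply: (@le_trans _ _ (u * (expR u - 1))); first by lra.
  rewrite expr2 -mulrA; exact: ler_wpM2l.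
apply: (@le_trans _ _ (u ^+ 2)).
  apply: (@le_trans _ _ (u * (expR u - 1))); first by lra.
  by rewrite expr2 ler_wnM2l ?(ltW u0)//; lra.
by rewrite ler_peMr ?sqr_ge0// -expR0 ler_expR.
Qed.

End Exponential.

Section Semigroup.
Context {R : realType} {S : choiceType}.
Variable Q : R -> S -> S -> R.
Hypothesis QP : transition_function Q.
Implicit Types f g : S -> R.

Let Qmass t x : 0 <= t -> prob_mass (Q t x).
Proof. by case: QP => + _ _; apply. Qed.

Lemma semigroup_summable t x f : 0 <= t -> bounded_fct f ->
  rsummable (fun y => Q t x y * f y).
Proof. by move=> t0 [C fC]; apply: prob_mass_rsummable fC; exact: Qmass. Qed.

Lemma bounded_fctD a b f g : bounded_fct f -> bounded_fct g ->
  bounded_fct (fun x => a * f x + b * g x).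
Proof.
move=> [C fC] [D gD]; exists (`|a| * C + `|b| * D) => x.
by rewrite (le_trans (ler_normD _ _))// !normrM lerD// ler_wpM2l.
Qed.

Lemma semigroup_lin t x a b f g : 0 <= t -> bounded_fct f -> bounded_fct g ->
  semigroup Q t (fun y => a * f y + b * g y) x =
  a * semigroup Q t f x + b * semigroup Q t g x.
Proof.
move=> t0 bf bg; rewrite /semigroup -!rsumZ; try exact: semigroup_summable.
rewrite -rsumD; try by apply: rsummableZ; exact: semigroup_summable.
by congr rsum; apply/funext => y; ring.
Qed.

Lemma semigroup_cst t x c : 0 <= t -> semigroup Q t (fun=> c) x = c.
Proof. by move=> t0; rewrite /semigroup prob_mass_avg_cst//; exact: Qmass. Qed.

Lemma semigroup_le t x f g : 0 <= t -> bounded_fct f -> bounded_fct g ->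
  (forall y, f y <= g y) -> semigroup Q t f x <= semigroup Q t g x.
Proof.
move=> t0 bf bg fg; apply: ler_rsum; try exact: semigroup_summable.
by move=> y; rewrite ler_wpM2l//; have [] := Qmass x t0.
Qed.

Lemma semigroup_ge0 t x f : 0 <= t -> (forall y, 0 <= f y) -> 0 <= semigroup Q t f x.
Proof.
move=> t0 f0; apply: rsum_ge0 => y; rewrite mulr_ge0//.
by have [] := Qmass x t0.
Qed.

Lemma semigroup_bounded t f : 0 <= t -> bounded_fct f -> bounded_fct (semigroup Q t f).
Proof.
move=> t0 bf; have [C fC] := bf; exists C => x.
have bC c : bounded_fct (fun _ : S => c) by exists `|c|.
rewrite ler_norml; apply/andP; split.
  rewrite -(semigroup_cst x (- C) t0); apply: semigroup_le => // y.
  by have := fC y; rewrite ler_norml => /andP[].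
rewrite -(semigroup_cst x C t0); apply: semigroup_le => // y.
by apply: le_trans (fC y); exact: ler_norm.
Qed.

Lemma semigroup_esum t x f : 0 <= t -> bounded_fct f -> (forall y, 0 <= f y) ->
  (semigroup Q t f x)%:E = \esum_(y in [set: S]) (Q t x y * f y)%:E.
Proof.
move=> t0 bf f0; have Q0 y : 0 <= Q t x y by have [] := Qmass x t0.
rewrite rsum_ge0E// => [y|]; first by rewrite mulr_ge0.
have := semigroup_summable x t0 bf; apply: le_lt_trans; apply: le_esum => y _.
by rewrite lee_fin ler_norm.
Qed.

Lemma semigroup_comp s t x f : 0 <= s -> 0 <= t -> bounded_fct f ->
  (forall y, 0 <= f y) ->
  semigroup Q (s + t) f x = semigroup Q s (semigroup Q t f) x.
Proof.
move=> s0 t0 bf f0; apply: EFin_inj.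
rewrite !semigroup_esum//; [|exact: semigroup_bounded
  |by move=> y; exact: semigroup_ge0|exact: addr_ge0].
have Q0 r a b : 0 <= r -> 0 <= Q r a b by move=> r0; have [] := Qmass a r0.
have [_ _ CK] := QP.
transitivity (\esum_(y in [set: S]) \esum_(z in [set: S])
    (Q s x z * (Q t z y * f y))%:E)%E.
  apply: eq_esum => y _; rewrite mulrC EFinM CK// -esumZ//; last first.
    by move=> z; rewrite lee_fin mulr_ge0// Q0.
  by apply: eq_esum => z _; rewrite -EFinM; congr (_%:E); ring.
rewrite esum_exchange => [|y z]; last by rewrite lee_fin !mulr_ge0// Q0.
apply: eq_esum => z _; rewrite EFinM semigroup_esum// -esumZ ?Q0// => y.
by rewrite lee_fin mulr_ge0// Q0.
Qed.

End Semigroup.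

(** * Approximate eigenfunctions of a bounded generator *)

Section Duhamel.
Context {R : realType} {S : choiceType}.
Variables (Q : R -> S -> S -> R) (G : (S -> R) -> S -> R).
Hypotheses (QP : transition_function Q) (QG : has_generator Q G).
Implicit Types f g : S -> R.

Lemma generator_step f : bounded_fct f -> forall e, 0 < e ->
  exists2 d, 0 < d & forall s, 0 < s -> s < d -> forall x,
    `|semigroup Q s f x - f x - s * G f x| <= s * e.
Proof.
move=> bf e e0; have [d /= d0 dP] := QG bf e0.
exists d => // s s0 sd x.
have := dP s; rewrite /ball/= sub0r normrN gtr0_norm// => /(_ sd s0 x)/ltW.
have -> : semigroup Q s f x - f x - s * G f x =
  s * (s^-1 * (semigroup Q s f x - f x) - G f x).
  by rewrite mulrBr mulrA mulfV ?gt_eqF// mul1r.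
by rewrite normrM gtr0_norm// ler_pM2l.
Qed.

Lemma small_times (t d : R) : 0 < t -> 0 < d ->
  exists n, 0 < t / n.+1%:R < d.
Proof.
move=> t0 d0; have dt := divr_gt0 d0 t0.
have [n _ nP] := near_infty_natSinv_lt (PosNum dt).
exists n; rewrite divr_gt0//= mulrC -ltr_pdivlMr//; exact: (nP n (leqnn n)).
Qed.

(** Over a short time [s] the function is multiplied by at most
    [1 + c s <= expR (c s)] up to an error [s e'].  Over the [n] steps with
    [n s = t] these errors add up to at most [t * expR (c t) * e'], and [e'] is
    arbitrary. *)
Lemma semigroup_growth c g : 0 <= c -> bounded_fct g -> (forall x, 0 <= g x) ->
  (forall x, G g x <= c * g x) ->
  forall t x, 0 < t -> semigroup Q t g x <= expR (c * t) * g x.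
Proof.
move=> c0 bg g0 Gg t x t0.
have bC (a : R) : bounded_fct (fun _ : S => a) by exists `|a|.
apply/ler_addgt0Pr => e e0.
pose e' := e / (t * expR (c * t)).
have e'0 : 0 < e' by rewrite divr_gt0// mulr_gt0// expR_gt0.
have [d d0 dP] := generator_step bg e'0.
have [n /andP[s0 sd]] := small_times t0 d0.
pose s := t / n.+1%:R.
have step y : semigroup Q s g y <= expR (c * s) * g y + s * e'.
  have := dP s s0 sd y; rewrite ler_norml => /andP[_ h].
  have h1 := expR_ge1Dx (c * s).
  have h2 : s * G g y <= s * (c * g y) by rewrite ler_pM2l.
  have h3 : (1 + c * s) * g y <= expR (c * s) * g y by rewrite ler_wpM2r.
  lra.
have key m y : semigroup Q (m.+1%:R * s) g y <=
    expR (c * (m.+1%:R * s)) * (g y + m.+1%:R * s * e').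
  elim: m y => [|m IH] y.
    rewrite mul1r mulrDr (le_trans (step y))// lerD2l ler_peMl//.
      by rewrite mulr_ge0// ltW.
    by rewrite -expR0 ler_expR mulr_ge0// ltW.
  have ms0 : 0 <= m.+1%:R * s by rewrite mulr_ge0// ltW.
  rewrite (_ : m.+2%:R * s = s + m.+1%:R * s); last by rewrite -natr1; ring.
  rewrite (semigroup_comp QP)//; last exact: ltW.
  set E := expR (c * (m.+1%:R * s)) in IH *.
  have E0 : 0 <= E by exact/ltW/expR_gt0.
  apply: (@le_trans _ _ (semigroup Q s (fun z => E * g z + E * (m.+1%:R * s * e')) y)).
    apply: (semigroup_le QP) => //; first exact: ltW.
    - exact: semigroup_bounded.
    - exact: (@bounded_fctD _ _ _ _ g (fun=> _)).
    - by move=> z; rewrite -mulrDr; exact: IH.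
  rewrite (@semigroup_lin _ _ _ QP s y E E g (fun=> _))//; last exact: ltW.
  rewrite (semigroup_cst QP) ?(ltW s0)// -mulrDr [c * (_ + _)]mulrDr expRD -/E.
  rewrite [_ * E]mulrC -[leRHS]mulrA.
  rewrite ler_wpM2l//.
  have h1 : 1 <= expR (c * s) by rewrite -expR0 ler_expR mulr_ge0// ltW.
  have h2 : s * e' + m.+1%:R * s * e' <= expR (c * s) * ((s + m.+1%:R * s) * e').
    by rewrite -mulrDl ler_peMl// mulr_ge0// ?(ltW e'0)// addr_ge0// ltW.
  have := step y; rewrite mulrDr; lra.
have := key n x; rewrite /s mulrCA mulfV ?mulr1//.
rewrite mulrDr /e' => /le_trans; apply; rewrite lerD2l.
rewrite le_eqVlt; apply/orP; left; apply/eqP; field.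
by rewrite !gt_eqF ?expR_gt0.
Qed.

Lemma generator_step_exp f g F : bounded_fct f ->
  (forall x, `|G f x - F * f x| <= g x) -> forall e, 0 < e ->
  exists2 d, 0 < d & forall s, 0 < s -> s < d -> forall x,
    `|semigroup Q s f x - expR (F * s) * f x| <= s * (g x + e).
Proof.
move=> bf Gf e e0; have e20 : 0 < e / 2 by rewrite divr_gt0.
have [d d0 dP] := generator_step bf e20.
have [C fC] := bf.
pose K := F ^+ 2 * expR `|F| * `|C| + 1.
have K0 : 0 < K.
  rewrite /K ltr_wpDl//; apply: mulr_ge0 => //.
  by apply: mulr_ge0; [exact: sqr_ge0|exact: expR_ge0].
exists (Num.min d (Num.min 1 (e / 2 / K))).
  by rewrite !lt_min d0 ltr01 divr_gt0.
move=> s s0; rewrite !lt_min => /and3P[sd s1 sK] x.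
have h1 := dP s s0 sd x.
have h2 : s * `|G f x - F * f x| <= s * g x by rewrite ler_pM2l.
have h3 : `|expR (F * s) - 1 - F * s| * `|f x| <= s * (e / 2).
  apply: (@le_trans _ _ (s * (s * K))); last first.
    by rewrite ler_pM2l// -ler_pdivlMr// ltW.
  apply: (@le_trans _ _ (s ^+ 2 * (F ^+ 2 * expR `|F|) * `|C|)).
    apply: ler_pM => //; last by rewrite (le_trans (fC x))// ler_norm.
    apply: (le_trans (expR_remainder _)).
    rewrite (_ : _ * expR `|F * s| = s ^+ 2 * (F ^+ 2 * expR `|F * s|)); last by ring.
    apply: ler_wpM2l; first exact: sqr_ge0.
    apply: ler_wpM2l; first exact: sqr_ge0.
    by rewrite ler_expR normrM (gtr0_norm s0) ler_piMr// ltW.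
  rewrite /K expr2 -!mulrA ler_pM2l// ler_pM2l// !mulrA lerDl//.
have -> : semigroup Q s f x - expR (F * s) * f x =
  (semigroup Q s f x - f x - s * G f x) + s * (G f x - F * f x)
  - (expR (F * s) - 1 - F * s) * f x by ring.
rewrite (le_trans (ler_normB _ _))// (normrM (expR _ - _ - _)).
have h4 := ler_normD (semigroup Q s f x - f x - s * G f x) (s * (G f x - F * f x)).
rewrite (normrM s) (gtr0_norm s0) in h4.
lra.
Qed.

(** Discrete form of the variation-of-constants formula: the defect [g] made at
    each short step is carried by the remaining steps, which multiply it by at
    most [expR (c t)], while [f] itself is multiplied by [expR (F t)]. *)
Lemma semigroup_approx_eigen f g F c : 0 <= c -> bounded_fct f -> bounded_fct g ->
  (forall x, 0 <= f x) -> (forall x, 0 <= g x) ->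
  (forall x, `|G f x - F * f x| <= g x) -> (forall x, G g x <= c * g x) ->
  forall t x, 0 < t ->
    `|semigroup Q t f x - expR (F * t) * f x| <= t * expR ((`|F| + c) * t) * g x.
Proof.
move=> c0 bf bg f0 g0 Gf Gg t x t0.
have bC (a : R) : bounded_fct (fun _ : S => a) by exists `|a|.
have bM (a : R) (h : S -> R) : bounded_fct h -> bounded_fct (fun y => a * h y).
  by move=> [D hD]; exists (`|a| * D) => y; rewrite normrM ler_wpM2l.
pose b := `|F| + c; have b0 : 0 <= b by rewrite addr_ge0.
have Fb : F <= b by rewrite /b; have := ler_norm F; lra.
apply/ler_addgt0Pr => e e0.
pose e' := e / (t * expR (b * t)).
have e'0 : 0 < e' by rewrite divr_gt0// mulr_gt0// expR_gt0.
have [d d0 dP] := generator_step_exp bf Gf e'0.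
have [n /andP[s0 sd]] := small_times t0 d0.
pose s := t / n.+1%:R.
pose h y := g y + e'.
have h0 y : 0 <= h y by rewrite addr_ge0// ltW.
have bh : bounded_fct h.
  by have := @bounded_fctD _ _ 1 1 g (fun=> e') bg (bC e'); congr bounded_fct;
     apply/funext => y; rewrite !mul1r.
have s0' : 0 <= s by exact: ltW.
have step y : `|semigroup Q s f y - expR (F * s) * f y| <= s * h y by exact: dP.
have growth y : semigroup Q s h y <= expR (b * s) * h y.
  have -> : h = (fun y => 1 * g y + 1 * e') by apply/funext => z; rewrite !mul1r.
  rewrite (@semigroup_lin _ _ _ QP s y 1 1 g (fun=> e'))//.
  rewrite (semigroup_cst QP)// !mul1r mulrDr lerD//.
    apply: (le_trans (semigroup_growth c0 bg g0 Gg _ s0)).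
    by rewrite ler_wpM2r// ler_expR ler_wpM2r// /b lerDr.
  by rewrite ler_peMl ?(ltW e'0)// -expR0 ler_expR mulr_ge0.
have key m y : `|semigroup Q (m.+1%:R * s) f y - expR (F * (m.+1%:R * s)) * f y| <=
    m.+1%:R * s * expR (b * (m.+1%:R * s)) * h y.
  elim: m y => [|m IH] y.
    rewrite mul1r (le_trans (step y))// ler_wpM2r// ler_peMr//.
    by rewrite -expR0 ler_expR mulr_ge0.
  set r := m.+1%:R * s in IH *.
  have r0 : 0 <= r by rewrite mulr_ge0.
  have -> : m.+2%:R * s = s + r by rewrite /r -natr1; ring.
  rewrite (semigroup_comp QP)//.
  set E := expR (F * r) in IH *; set B := expR (b * r) in IH *.
  have E0 : 0 <= E by exact/ltW/expR_gt0.
  have EB : E <= B by rewrite ler_expR ler_wpM2r.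
  have B0 : 0 <= B by exact/ltW/expR_gt0.
  have b1 : 1 <= expR (b * s) by rewrite -expR0 ler_expR mulr_ge0.
  have bQf : bounded_fct (semigroup Q r f) by exact: semigroup_bounded.
  have U : semigroup Q s (semigroup Q r f) y <=
      E * semigroup Q s f y + r * B * semigroup Q s h y.
    rewrite -(semigroup_lin QP)//; apply: (semigroup_le QP) => //.
      exact: bounded_fctD.
    by move=> z; have := IH z; rewrite ler_norml => /andP[_]; lra.
  have L : E * semigroup Q s f y <=
      1 * semigroup Q s (semigroup Q r f) y + r * B * semigroup Q s h y.
    have -> : E * semigroup Q s f y = E * semigroup Q s f y + 0 * semigroup Q s f y.
      by ring.
    rewrite -!(semigroup_lin QP)//; apply: (semigroup_le QP) => //.
    - exact: bounded_fctD.
    - exact: bounded_fctD.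
    - by move=> z; have := IH z; rewrite ler_norml => /andP[]; lra.
  have W : E * `|semigroup Q s f y - expR (F * s) * f y| <= B * (expR (b * s) * (s * h y)).
    apply: ler_pM => //; apply: (le_trans (step y)).
    by rewrite ler_peMl// mulr_ge0.
  have W' : r * B * semigroup Q s h y <= r * B * (expR (b * s) * h y).
    by apply: ler_wpM2l; [exact: mulr_ge0|exact: growth].
  have -> : expR (F * (s + r)) = expR (F * s) * E by rewrite mulrDr expRD.
  have -> : expR (b * (s + r)) = expR (b * s) * B by rewrite mulrDr expRD.
  have := ler_norm (semigroup Q s f y - expR (F * s) * f y).
  have := ler_norm (- (semigroup Q s f y - expR (F * s) * f y)).
  rewrite normrN => /(ler_wpM2l E0) n1 /(ler_wpM2l E0) n2.
  rewrite ler_norml; apply/andP; split; lra.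
have := key n x; rewrite /s mulrCA mulfV ?mulr1// => /le_trans; apply.
rewrite /h mulrDr /e' lerD2l.
rewrite le_eqVlt; apply/orP; left; apply/eqP; field.
by rewrite !gt_eqF ?expR_gt0.
Qed.

End Duhamel.

(** * Exponential functions and the generator of the active particle *)

Section Dot.
Context {R : realType} {d : nat}.
Implicit Types (a b : 'rV[R]_d) (x z : 'rV[int]_d).

Lemma dotDl a b c : dot (a + b) c = dot a c + dot b c.
Proof. by rewrite /dot -big_split/=; apply: eq_bigr => i _; rewrite mxE mulrDl. Qed.

Lemma dotDr a b c : dot a (b + c) = dot a b + dot a c.
Proof. by rewrite /dot -big_split/=; apply: eq_bigr => i _; rewrite mxE mulrDr. Qed.

Lemma dotZl k a b : dot (k *: a) b = k * dot a b.
Proof. by rewrite /dot mulr_sumr; apply: eq_bigr => i _; rewrite mxE mulrA. Qed.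

Lemma dotZr k a b : dot a (k *: b) = k * dot a b.
Proof. by rewrite /dot mulr_sumr; apply: eq_bigr => i _; rewrite mxE mulrCA. Qed.

Lemma dot0l b : dot 0 b = 0.
Proof. by rewrite /dot big1// => i _; rewrite mxE mul0r. Qed.

Lemma dot0r b : dot b 0 = 0.
Proof. by rewrite /dot big1// => i _; rewrite mxE mulr0. Qed.

Lemma real_vecD x z : real_vec (x + z) = real_vec x + real_vec z :> 'rV[R]_d.
Proof. by apply/rowP => i; rewrite !mxE intrD. Qed.

Lemma real_vec0 : real_vec 0 = 0 :> 'rV[R]_d.
Proof. by apply/rowP => i; rewrite !mxE. Qed.

Definition expo a x : R := expR (dot a (real_vec x)).

Lemma expoD a x z : expo a (x + z) = expo a x * expo a z.
Proof. by rewrite /expo real_vecD dotDr expRD. Qed.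

Lemma expo0 a : expo a 0 = 1.
Proof. by rewrite /expo real_vec0 dot0r expR0. Qed.

Lemma expo_gt0 a x : 0 < expo a x.
Proof. exact: expR_gt0. Qed.

Lemma expo_sqr a x : expo a x ^+ 2 = expo (2 *: a) x.
Proof. by rewrite /expo dotZl -expRM_natl. Qed.

End Dot.

Section Generator.
Context {R : realType} {d : nat} {V : {fset 'rV[int]_d}}.
Variables (lambda kappa gamma : R) (p : 'rV[int]_d -> R) (pi : V -> V -> R).
Hypotheses (hlambda : 0 <= lambda) (hkappa : 0 <= kappa) (hgamma : 0 < gamma).
Hypotheses (hp : prob_mass p) (hpi : forall v v', 0 <= pi v v').
Hypothesis hpexp : forall alpha : 'rV[R]_d,
    (\esum_(z in [set: 'rV[int]_d])
       (expR (dot alpha (real_vec z)) * p z)%:E < +oo)%E.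

Local Notation state := ('rV[int]_d * V)%type.
Local Notation L := (generatorL lambda kappa gamma p pi).
Implicit Types h k : state -> R.

Let p0 z : 0 <= p z. Proof. by case: hp. Qed.

Definition jump h (x : state) : R :=
  lambda * h (x.1 + val x.2, x.2)
  + kappa * rsum (fun z => p z * h (x.1 + z, x.2))
  + gamma * \sum_(v' : V) pi x.2 v' * h (x.1, v').

Definition total_rate (v : V) : R := lambda + kappa + gamma * \sum_(v' : V) pi v v'.

(** Summability of the jump part, which makes sense of the generator on functions
    that need not be bounded. *)
Definition jumpable h : Prop :=
  forall x : state, rsummable (fun z => p z * h (x.1 + z, x.2)).

Lemma generatorL_jump h x : jumpable h -> L h x = jump h x - total_rate x.2 * h x.
Proof.
move=> jh; rewrite /generatorL /Lt /Ld /Lf /jump /total_rate.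
have -> : rsum (fun z => p z * (h (x.1 + z, x.2) - h x)) =
    rsum (fun z => p z * h (x.1 + z, x.2)) - h x.
  rewrite (_ : (fun z => _) = (fun z => p z * h (x.1 + z, x.2) + p z * (- h x))).
    rewrite rsumD ?prob_mass_avg_cst//.
    by apply: (@prob_mass_rsummable _ _ _ hp (fun=> - h x) `|h x|) => z; rewrite normrN.
  by apply/funext => z; rewrite mulrDr.
have -> : \sum_(v' : V) pi x.2 v' * (h (x.1, v') - h x) =
    \sum_(v' : V) pi x.2 v' * h (x.1, v') - (\sum_(v' : V) pi x.2 v') * h x.
  by rewrite mulr_suml -sumrB; apply: eq_bigr => v' _; rewrite mulrBr.
ring.
Qed.

Lemma jumpable_bounded h : bounded_fct h -> jumpable h.
Proof. by move=> [C hC] x; apply: (prob_mass_rsummable hp) => z; exact: hC. Qed.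

Lemma jumpable_lin a b h k : jumpable h -> jumpable k ->
  jumpable (fun x => a * h x + b * k x).
Proof.
move=> jh jk x; rewrite (_ : (fun z => _) = (fun z => a * (p z * h (x.1 + z, x.2)) +
   b * (p z * k (x.1 + z, x.2)))); last by apply/funext => z; ring.
by apply: rsummableD; apply: rsummableZ; [exact: jh|exact: jk].
Qed.

Lemma jump_lin a b h k x : jumpable h -> jumpable k ->
  jump (fun x => a * h x + b * k x) x = a * jump h x + b * jump k x.
Proof.
move=> jh jk; rewrite /jump.
rewrite (_ : (fun z => _) = (fun z => a * (p z * h (x.1 + z, x.2)) +
   b * (p z * k (x.1 + z, x.2)))); last by apply/funext => z; ring.
rewrite rsumD; [|exact/rsummableZ/jh|exact/rsummableZ/jk].
rewrite !rsumZ; [|exact: jk|exact: jh].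
rewrite (eq_bigr (fun v' => a * (pi x.2 v' * h (x.1, v')) + b * (pi x.2 v' * k (x.1, v')))).
  by rewrite big_split/= -!mulr_sumr; ring.
by move=> v' _; ring.
Qed.

Lemma jump_le h k x : jumpable h -> jumpable k -> (forall y, h y <= k y) ->
  jump h x <= jump k x.
Proof.
move=> jh jk hk; rewrite /jump !lerD//; first exact: ler_wpM2l.
  by apply: ler_wpM2l => //; apply: ler_rsum => // z; exact: ler_wpM2l.
apply: ler_wpM2l; first exact: ltW.
by apply: ler_sum => v' _; exact: ler_wpM2l.
Qed.

Lemma jump_cst c x : jump (fun=> c) x = total_rate x.2 * c.
Proof.
by rewrite /jump /total_rate prob_mass_avg_cst// -mulr_suml; ring.
Qed.

Lemma jump_ge0 h x : (forall y, 0 <= h y) -> 0 <= jump h x.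
Proof.
move=> h0; rewrite /jump !addr_ge0// mulr_ge0//.
- by apply: rsum_ge0 => z; exact: mulr_ge0.
- exact: ltW.
- by apply: sumr_ge0 => v' _; exact: mulr_ge0.
Qed.

Lemma total_rate_ge0 v : 0 <= total_rate v.
Proof. by rewrite /total_rate !addr_ge0// mulr_ge0 ?sumr_ge0// ltW. Qed.

Lemma expo_summable alpha : rsummable (fun z => p z * expo alpha z).
Proof.
apply: rsummable_le (hpexp alpha) => z.
by rewrite ger0_norm ?mulr_ge0 ?(ltW (expo_gt0 _ _))// mulrC.
Qed.

Definition expo_fct alpha (r : V -> R) (x : state) : R := expo alpha x.1 * r x.2.

Lemma expo_fct_jumpable alpha r : jumpable (expo_fct alpha r).
Proof.
move=> x; rewrite /expo_fct /=.
rewrite (_ : (fun z => _) = (fun z => (expo alpha x.1 * r x.2) * (p z * expo alpha z))).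
  exact/rsummableZ/expo_summable.
by apply/funext => z; rewrite expoD; ring.
Qed.

Lemma jump_expo_fct alpha r x : jump (expo_fct alpha r) x =
  expo alpha x.1 * ((lambda * expo alpha (val x.2)
      + kappa * rsum (fun z => p z * expo alpha z)) * r x.2
      + gamma * \sum_(v' : V) pi x.2 v' * r v').
Proof.
rewrite /jump /expo_fct /= (_ : (fun z => _) =
    (fun z => (expo alpha x.1 * r x.2) * (p z * expo alpha z))); last first.
  by apply/funext => z; rewrite expoD; ring.
rewrite rsumZ; last exact: expo_summable.
rewrite expoD (eq_bigr (fun v' => expo alpha x.1 * (pi x.2 v' * r v'))).
  by rewrite -mulr_sumr; ring.
by move=> v' _; ring.
Qed.

Lemma GammaE alpha : Gamma p alpha = rsum (fun z => p z * expo alpha z) - 1.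
Proof.
rewrite /Gamma (_ : (fun z => _) = (fun z => p z * expo alpha z + p z * (-1))).
  rewrite rsumD ?prob_mass_avg_cst//; first exact: expo_summable.
  by apply: (@prob_mass_rsummable _ _ _ hp (fun=> -1) 1) => z; rewrite normrN normr1.
by apply/funext => z; rewrite -/(expo alpha z); ring.
Qed.

(** The exponential factors out of every jump term, leaving the Feynman-Kac operator
    on the velocities: an eigenvector [r] becomes an unbounded eigenfunction. *)
Lemma generatorL_expo_fct alpha r F x :
  (forall v, \sum_v' fk_kernel gamma pi (psi lambda kappa p alpha) v v' * r v' = F * r v) ->
  L (expo_fct alpha r) x = F * expo_fct alpha r x.
Proof.
move=> rE; rewrite generatorL_jump; last exact: expo_fct_jumpable.
rewrite jump_expo_fct /expo_fct [RHS](_ : _ = expo alpha x.1 * (F * r x.2)); last by ring.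
rewrite -rE fk_kernel_sum /psi GammaE -/(expo _ _).
rewrite /total_rate /flip_generator.
have -> : \sum_(v' : V) pi x.2 v' * (r v' - r x.2) =
    \sum_(v' : V) pi x.2 v' * r v' - (\sum_(v' : V) pi x.2 v') * r x.2.
  by rewrite mulr_suml -sumrB; apply: eq_bigr => v' _; rewrite mulrBr.
by ring.
Qed.

Section Truncation.
Variables (alpha : 'rV[R]_d) (r : V -> R) (F : R).
Hypothesis r0 : forall v, 0 < r v.
Hypothesis rE : forall v,
  \sum_v' fk_kernel gamma pi (psi lambda kappa p alpha) v v' * r v' = F * r v.

Let f := expo_fct alpha r.
Let fN (N : R) x := Num.min (f x) N.
Let f2 x := f x ^+ 2.

Let f_gt0 x : 0 < f x.
Proof. by rewrite /f /expo_fct mulr_gt0// expo_gt0. Qed.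

Let f2E : f2 = expo_fct (2 *: alpha) (fun v => r v ^+ 2).
Proof. by apply/funext => x; rewrite /f2 /f /expo_fct exprMn expo_sqr. Qed.

Let jf : jumpable f. Proof. exact: expo_fct_jumpable. Qed.
Let jf2 : jumpable f2. Proof. rewrite f2E; exact: expo_fct_jumpable. Qed.

Let c : R := \sum_(v : V) ((lambda * expo (2 *: alpha) (val v)
      + kappa * rsum (fun z => p z * expo (2 *: alpha) z))
      + gamma * (\sum_(v' : V) pi v v' * r v' ^+ 2) / r v ^+ 2).

Let cterm_ge0 (v : V) : 0 <= (lambda * expo (2 *: alpha) (val v)
      + kappa * rsum (fun z => p z * expo (2 *: alpha) z))
      + gamma * (\sum_(v' : V) pi v v' * r v' ^+ 2) / r v ^+ 2.
Proof.
rewrite !addr_ge0//.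
- by rewrite mulr_ge0// ltW// expo_gt0.
- by rewrite mulr_ge0// rsum_ge0// => z; rewrite mulr_ge0// ltW// expo_gt0.
- rewrite divr_ge0 ?sqr_ge0// mulr_ge0 ?(ltW hgamma)// sumr_ge0// => v' _.
  by rewrite mulr_ge0// sqr_ge0.
Qed.

Let c_ge0 : 0 <= c. Proof. by apply: sumr_ge0 => v _. Qed.

Let jump_f2 x : jump f2 x <= c * f2 x.
Proof.
rewrite f2E jump_expo_fct /expo_fct.
rewrite [leRHS](_ : _ = expo (2 *: alpha) x.1 * (c * r x.2 ^+ 2)); last by ring.
rewrite ler_pM2l ?expo_gt0//.
rewrite [c](bigD1 x.2)//= [leRHS]mulrDl; apply: ler_wpDr.
  by apply: mulr_ge0; [apply: sumr_ge0 => v _; exact: cterm_ge0|exact: sqr_ge0].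
by rewrite [leRHS]mulrDl divfK// expf_neq0// gt_eqF.
Qed.

Let Lmax : R := \sum_v total_rate v.
Let rate_le v : total_rate v <= Lmax.
Proof. by rewrite /Lmax (bigD1 v)//= lerDl sumr_ge0// => w _; exact: total_rate_ge0. Qed.

Let fN_bounded N : 0 < N -> bounded_fct (fN N).
Proof.
move=> N0; exists N => x; rewrite ger0_norm ?ge_min ?lexx ?orbT//.
by rewrite le_min !ltW.
Qed.

Let fN2_bounded N : 0 < N -> bounded_fct (fun x => fN N x ^+ 2).
Proof.
move=> N0; have [C fC] := fN_bounded N0; exists (C ^+ 2) => x.
by rewrite normrX lerXn2r ?nnegrE ?(le_trans _ (fC x)).
Qed.

Let fN_ge0 N x : 0 < N -> 0 <= fN N x. Proof. by move=> N0; rewrite le_min !ltW. Qed.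

Let C0 := c + Lmax + `|F|.

Let Lmax_ge0 : 0 <= Lmax. Proof. by apply: sumr_ge0 => v _; exact: total_rate_ge0. Qed.

Let C0_ge0 : 0 <= C0. Proof. by rewrite !addr_ge0. Qed.

(** Where [f <= N] truncation only loses jumps into [f > N], and
    [(f - N)^+ <= f^2 / N]; where [f > N] all terms are of order [N = N^2 / N]. *)
Let trunc_defect N x : 0 < N ->
  `|L (fN N) x - F * fN N x| <= C0 / N * fN N x ^+ 2.
Proof.
move=> N0; have jN : jumpable (fN N) by apply/jumpable_bounded/fN_bounded.
rewrite generatorL_jump//; have [fle|flt] := leP (f x) N.
  have fNx : fN N x = f x by rewrite /fN min_l.
  have := generatorL_expo_fct x rE; rewrite -/f generatorL_jump// => Lf.
  have j1 : jump (fN N) x <= jump f x.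
    by apply: jump_le => // y; rewrite /fN ge_min lexx.
  have j2 : jump f x <= jump (fN N) x + N^-1 * jump f2 x.
    have -> : jump (fN N) x + N^-1 * jump f2 x = 1 * jump (fN N) x + N^-1 * jump f2 x.
      by ring.
    rewrite -jump_lin//; apply: jump_le => //; first exact: jumpable_lin.
    move=> y; rewrite mul1r /fN /f2; case: (leP (f y) N) => fy.
      by rewrite lerDl mulr_ge0 ?sqr_ge0// invr_ge0 ltW.
    apply: (@le_trans _ _ (N^-1 * (f y * f y))).
      by rewrite mulrA -[leLHS]mul1r ler_wpM2r ?(ltW (f_gt0 y))// ler_pdivlMl// mulr1 ltW.
    by rewrite -expr2 lerDr ltW.
  have j3 : N^-1 * jump f2 x <= N^-1 * (c * f2 x) by rewrite ler_pM2l ?invr_gt0.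
  have j4 : 0 <= N^-1 * ((Lmax + `|F|) * f2 x).
    apply: mulr_ge0; first by rewrite invr_ge0 ltW.
    by apply: mulr_ge0; [exact: addr_ge0|exact: sqr_ge0].
  have -> : C0 / N * fN N x ^+ 2 = N^-1 * (c * f2 x) + N^-1 * ((Lmax + `|F|) * f2 x).
    by rewrite fNx /C0 /f2; ring.
  rewrite fNx ler_norml; apply/andP; split; lra.
have fNx : fN N x = N by rewrite /fN min_r// ltW.
rewrite fNx.
have -> : C0 / N * N ^+ 2 = C0 * N by field; rewrite gt_eqF.
have j0 : 0 <= jump (fN N) x by apply: jump_ge0 => y; exact: fN_ge0.
have j1 : jump (fN N) x <= total_rate x.2 * N.
  rewrite -jump_cst; apply: jump_le => //; last by move=> y; rewrite /fN ge_min lexx orbT.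
  by apply: jumpable_bounded; exists `|N|.
have j2 : total_rate x.2 * N <= Lmax * N by rewrite ler_pM2r.
have j3 : F * N <= `|F| * N by rewrite ler_pM2r// ler_norm.
have j4 : - F * N <= `|F| * N by rewrite ler_pM2r// -normrN ler_norm.
have j5 : 0 <= c * N by rewrite mulr_ge0// ltW.
rewrite /C0 ler_norml; apply/andP; split; lra.
Qed.

Let trunc_sqr_growth N x : 0 < N ->
  L (fun x => C0 / N * fN N x ^+ 2) x <= c * (C0 / N * fN N x ^+ 2).
Proof.
move=> N0.
have j2 : jumpable (fun x => fN N x ^+ 2) by apply/jumpable_bounded/fN2_bounded.
have -> : (fun x => C0 / N * fN N x ^+ 2) =
    (fun x => C0 / N * fN N x ^+ 2 + 0 * fN N x ^+ 2).
  by apply/funext => y; ring.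
rewrite generatorL_jump ?jump_lin//; last exact: jumpable_lin.
have CN : 0 <= C0 / N by rewrite divr_ge0// ltW.
suff : jump (fun x => fN N x ^+ 2) x - total_rate x.2 * fN N x ^+ 2 <= c * fN N x ^+ 2.
  by move=> /(ler_wpM2l CN); lra.
have Lam0 := total_rate_ge0 x.2.
have [fle|flt] := leP (f x) N.
  have -> : fN N x = f x by rewrite /fN min_l.
  have h1 : jump (fun x => fN N x ^+ 2) x <= jump f2 x.
    apply: jump_le => // y; rewrite /f2 lerXn2r ?nnegrE ?fN_ge0 ?(ltW (f_gt0 y))//.
    by rewrite /fN ge_min lexx.
  have h2 := jump_f2 x; have h3 : 0 <= total_rate x.2 * f x ^+ 2.
    by apply: mulr_ge0 => //; exact: sqr_ge0.
  rewrite /f2 in h2; lra.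
have -> : fN N x = N by rewrite /fN min_r// ltW.
have h1 : jump (fun x => fN N x ^+ 2) x <= total_rate x.2 * N ^+ 2.
  rewrite -jump_cst; apply: jump_le => // [|y].
    by apply: jumpable_bounded; exists `|N ^+ 2|.
  rewrite lerXn2r ?nnegrE ?fN_ge0 ?(ltW N0)//.
  by rewrite /fN ge_min lexx orbT.
have h2 : 0 <= c * N ^+ 2 by apply: mulr_ge0 => //; exact: sqr_ge0.
lra.
Qed.

(** Along the flow of the bounded truncations [min f N] the eigenvalue relation
    holds up to an error of order [1 / N], controlled by the Lyapunov function
    [(min f N) ^ 2]. *)
Lemma semigroup_truncation (Q : R -> state -> state -> R) t :
  transition_function Q -> has_generator Q L -> 0 < t ->
  exists C, forall N x, 0 < N ->
    `|semigroup Q t (fun y => Num.min (expo_fct alpha r y) N) x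
      - expR (F * t) * Num.min (expo_fct alpha r x) N| <=
    C / N * (Num.min (expo_fct alpha r x) N) ^+ 2.
Proof.
move=> QP QG t0; exists (t * expR ((`|F| + c) * t) * C0) => N x N0.
have C0N : 0 <= C0 / N by rewrite divr_ge0// ltW.
apply: le_trans (semigroup_approx_eigen QP QG (g := fun y => C0 / N * fN N y ^+ 2)
  c_ge0 _ _ _ _ _ _ _ t0) _ => //.
- exact: fN_bounded.
- have [C hC] := fN2_bounded N0; exists (C0 / N * C) => y.
  by rewrite normrM (ger0_norm C0N) ler_wpM2l.
- by move=> y; exact: fN_ge0.
- by move=> y; rewrite mulr_ge0// sqr_ge0.
- by move=> y; exact: trunc_defect.
- by move=> y; exact: trunc_sqr_growth.
- by rewrite !mulrA.
Qed.

End Truncation.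
End Generator.

(** * Exponential moments of the process *)

Section DiscreteVariables.
Context {R : realType} {S : countType} {dO : measure_display}
  {Omega : measurableType dO}.
Variable P : probability Omega R.
Implicit Types (Y : Omega -> S) (f : S -> R).

Definition discrete_rv Y : Prop := forall A : set S, measurable (Y @^-1` A).

Lemma discrete_measurable_fun Y (u : S -> \bar R) :
  discrete_rv Y -> measurable_fun setT (fun w => u (Y w)).
Proof. by move=> mY _ B mB; rewrite setTI; exact: (mY (u @^-1` B)). Qed.

Lemma nneseries_pickle (g : nat -> \bar R) : (forall n, 0 <= g n)%E ->
  (forall n, (forall y : S, choice.pickle y <> n) -> g n = 0%E) ->
  (\sum_(n <oo) g n = \esum_(y in [set: S]) g (choice.pickle y))%E.
Proof.
move=> g0 gout; rewrite nneseries_esumT//.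
rewrite (esumID (range (@choice.pickle S)))// !setTI [X in (_ + X)%E]esum1 ?adde0.
  rewrite (@reindex_esum R S nat [set: S] (range (@choice.pickle S)) choice.pickle)//.
  by split => [y _|y y' _ _ /(pcan_inj choice.pickleK)//|_ [y _ <-]]; exists y.
by move=> n nr; apply: gout => y yn; apply: nr; exists y.
Qed.

Let fiber Y n := Y @^-1` [set y | choice.pickle y = n].

Let fiber_cover Y : \bigcup_n fiber Y n = setT.
Proof. by apply/seteqP; split => // w _; exists (choice.pickle (Y w)). Qed.

Let fiber_triv Y : trivIset setT (fiber Y).
Proof. by move=> i j _ _ [w [<- <-]]. Qed.

Let fiberE Y y : fiber Y (choice.pickle y) = Y @^-1` [set y].
Proof.
by apply/seteqP; split => w; [move/(pcan_inj choice.pickleK)|move=> /= <-].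
Qed.

Let fiber_out Y n : (forall y : S, choice.pickle y <> n) -> fiber Y n = set0.
Proof. by move=> h; apply/seteqP; split => // w /= /h. Qed.

Lemma measure_fibers Y A : discrete_rv Y -> measurable A ->
  (P A = \esum_(y in [set: S]) P (A `&` (Y @^-1` [set y])))%E.
Proof.
move=> mY mA; rewrite -[in LHS](setIT A) -(fiber_cover Y) setI_bigcupr.
rewrite measure_bigcup.
- rewrite (eq_eseriesl (Q := xpredT)); last by move=> n; rewrite in_setT.
  rewrite nneseries_pickle => [|//|n h]; last by rewrite fiber_out// setI0 measure0.
  by apply: eq_esum => y _; rewrite fiberE.
- by move=> n _; apply: measurableI => //; exact: mY.
- by apply: trivIset_setIl; exact: fiber_triv.
Qed.

Lemma integral_discrete Y f : discrete_rv Y -> (forall y, 0 <= f y) ->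
  (\int[P]_w (f (Y w))%:E =
   \esum_(y in [set: S]) ((f y)%:E * P (Y @^-1` [set y])))%E.
Proof.
move=> mY f0; rewrite -(fiber_cover Y) ge0_integral_bigcup.
- rewrite nneseries_pickle => [|n|n h]; last by rewrite fiber_out// integral_set0.
    apply: eq_esum => y _; rewrite fiberE.
    rewrite (eq_integral (cst (f y)%:E)); last by move=> w /set_mem /= ->.
    by rewrite integral_cst//; exact: mY.
  by apply: integral_ge0 => w _; rewrite lee_fin.
- by move=> n; exact: mY.
- rewrite fiber_cover; exact: (@discrete_measurable_fun Y (fun y => (f y)%:E)).
- by move=> w _; rewrite lee_fin.
- exact: fiber_triv.
Qed.

(** The Markov property between time [0] and time [t], summed over the states. *)
Lemma expectation_semigroup (Y : R -> Omega -> S) Q t f :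
  transition_function Q -> markov_process P Y Q -> 0 <= t -> bounded_fct f ->
  (forall y, 0 <= f y) ->
  (\int[P]_w (f (Y t w))%:E = \int[P]_w (semigroup Q t f (Y 0%R w))%:E)%E.
Proof.
move=> QP [mY mk] t0 bf f0.
have Q0 a b : 0 <= Q t a b by case: QP => /(_ t a t0)[].
have mYt : discrete_rv (Y t) by exact: mY.
have mY0 : discrete_rv (Y 0) by exact: mY.
rewrite !integral_discrete//; last by move=> y; exact: semigroup_ge0.
have [q0 Pq q0_ge0] : exists2 q0 : S -> R,
    forall x, P (Y 0 @^-1` [set x]) = (q0 x)%:E & forall x, 0 <= q0 x.
  exists (fun x => fine (P (Y 0 @^-1` [set x]))) => x; last exact: fine_ge0.
  by rewrite fineK// fin_num_measure//; exact: mY0.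
transitivity (\esum_(y in [set: S]) \esum_(x in [set: S])
   (q0 x * (Q t x y * f y))%:E)%E.
  apply: eq_esum => y _; rewrite (measure_fibers mY0); last exact: mYt.
  rewrite -esumZ//; apply: eq_esum => x _.
  have pastE : [set w | Y 0 w = x /\ forall u : R * S, u \in [::] -> Y u.1 w = u.2]
      = Y 0 @^-1` [set x].
    by apply/seteqP; split => w // [].
  have := mk [::] 0 t x y; rewrite subr0 pastE /= Pq setIC => -> //.
  by rewrite -!EFinM; congr (_%:E); ring.
rewrite esum_exchange => [|y x]; last by rewrite lee_fin !mulr_ge0.
apply: eq_esum => x _; rewrite (semigroup_esum QP)// Pq muleC -esumZr//.
by move=> y; exact: mulr_ge0.
Qed.

End DiscreteVariables.

Section Moments.
Context {R : realType} {d : nat} {V : {fset 'rV[int]_d}}.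
Variables (lambda kappa gamma : R) (p : 'rV[int]_d -> R) (pi : V -> V -> R).
Hypotheses (hlambda : 0 <= lambda) (hkappa : 0 <= kappa) (hgamma : 0 < gamma).
Hypotheses (hp : prob_mass p) (hpi : forall v v', 0 <= pi v v').
Hypothesis hpexp : forall alpha : 'rV[R]_d,
    (\esum_(z in [set: 'rV[int]_d])
       (expR (dot alpha (real_vec z)) * p z)%:E < +oo)%E.
Context {dO : measure_display} {Omega : measurableType dO}.
Variables (P : probability Omega R) (X : R -> Omega -> 'rV[int]_d) (v : R -> Omega -> V).
Hypothesis hXv : markov_process_with_generator P (fun t w => (X t w, v t w))
           (generatorL lambda kappa gamma p pi).
Hypothesis hX0 : (P [set w | X 0%R w = 0%R] = 1)%E.
Local Notation state := ('rV[int]_d * V)%type.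

Let Y t w : state := (X t w, v t w).

Lemma process_discrete t : 0 <= t -> discrete_rv (Y t).
Proof. by case: hXv => Q [_ _ [mY _]]; exact: mY. Qed.

Lemma process_measurable t (u : 'rV[int]_d -> \bar R) : 0 <= t ->
  measurable_fun setT (fun w => u (X t w)).
Proof.
move=> t0.
exact: (@discrete_measurable_fun R _ _ _ (Y t) (fun y => u y.1) (process_discrete t0)).
Qed.

Lemma initial_ae (Pr : Omega -> Prop) :
  (forall w, X 0 w = 0 -> Pr w) -> \forall w \ae P, Pr w.
Proof.
move=> h; have mX0 : measurable [set w | X 0 w = 0].
  exact: (process_discrete (lexx 0) [set y : state | y.1 = 0]).
exists (~` [set w | X 0 w = 0]); split.
- exact: measurableC.
- by have := probability_setC P mX0; rewrite hX0 subee.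
- by move=> w /= nPr X0; apply: nPr; exact: h.
Qed.

(** On the event [X 0 = 0] the truncations start from [r v], so their expectations
    lie within [O(1 / N)] of [expR (F t)] times values of [r]; monotone
    convergence removes the truncation, and [r] is bounded above and below. *)
Lemma mgf_bounds alpha F (r : V -> R) : (forall v, 0 < r v) ->
  (forall v, \sum_v' fk_kernel gamma pi (psi lambda kappa p alpha) v v' * r v' = F * r v) ->
  exists c C, [/\ 0 < c, 0 < C & forall t, 0 < t ->
    ((c * expR (F * t))%:E <= \int[P]_w (expo alpha (X t w))%:E <=
     (C * expR (F * t))%:E)%E].
Proof.
move=> r0 rE.
have [w0 _] : exists w : Omega, True.
  apply: contrapT => /forallNP h; have := probability_setT P.
  rewrite (_ : setT = set0) ?measure0; last by apply/seteqP; split => // w; have := h w.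
  by move/eqP; rewrite eq_sym onee_eq0.
have v0 : V := v 0 w0.
pose M := \sum_v r v; pose m := (\sum_v (r v)^-1)^-1.
have rM u : r u <= M.
  by rewrite /M (bigD1 u)//= lerDl sumr_ge0// => ? _; exact: ltW.
have sm0 : 0 < \sum_v (r v)^-1.
  by apply: (@psumr_gt0 _ _ _ v0) => [u|]; rewrite ?invr_gt0 ?invr_ge0 ?ltW.
have m0 : 0 < m by rewrite invr_gt0.
have rm u : m <= r u.
  rewrite /m -[r u]invrK lef_pV2 ?posrE ?invr_gt0//.
  by rewrite (bigD1 u)//= lerDl sumr_ge0// => ? _; rewrite invr_ge0 ltW.
have M0 : 0 < M by apply: lt_le_trans (r0 v0) _.
pose f := expo_fct alpha r.
have f0 x : 0 < f x by rewrite /f /expo_fct mulr_gt0// expo_gt0.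
exists (m / M), (M / m); split; rewrite ?divr_gt0// => t t0.
have [Q [QP QG mk]] := hXv.
have [C hC] := semigroup_truncation hlambda hkappa hgamma hp hpi hpexp r0 rE QP QG t0.
pose I := (\int[P]_w (f (Y t w))%:E)%E.
pose IN (N : R) := (\int[P]_w (Num.min (f (Y t w)) N)%:E)%E.
have E0 : 0 < expR (F * t) by exact: expR_gt0.
have C_ge0 : 0 <= `|C| * M ^+ 2 by apply: mulr_ge0 => //; exact: sqr_ge0.
have INE N : M < N ->
    ((expR (F * t) * m - `|C| * M ^+ 2 / N)%:E <= IN N <=
     (expR (F * t) * M + `|C| * M ^+ 2 / N)%:E)%E.
  move=> MN; have N0 : 0 < N by exact: lt_trans MN.
  have bN : bounded_fct (fun y : state => Num.min (f y) N).
    exists N => x; rewrite ger0_norm ?ge_min ?lexx ?orbT//.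
    by rewrite le_min !ltW.
  have pN (y : state) : 0 <= Num.min (f y) N by rewrite le_min !ltW.
  rewrite /IN (expectation_semigroup QP mk (ltW t0) bN pN).
  have key w : X 0 w = 0 ->
      expR (F * t) * m - `|C| * M ^+ 2 / N <=
      semigroup Q t (fun y => Num.min (f y) N) (Y 0 w) <=
      expR (F * t) * M + `|C| * M ^+ 2 / N.
    move=> Xw; have := hC N (Y 0 w) N0.
    have fr : f (Y 0 w) = r (v 0 w) by rewrite /f /expo_fct /= Xw expo0 mul1r.
    rewrite -/f fr min_l; last by rewrite ltW// (le_lt_trans (rM _)).
    have hb : C / N * r (v 0 w) ^+ 2 <= `|C| * M ^+ 2 / N.
      rewrite mulrAC ler_pM2r ?invr_gt0//.
      apply: (@le_trans _ _ (`|C| * r (v 0 w) ^+ 2)).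
        by rewrite ler_wpM2r ?sqr_ge0// ler_norm.
      by apply: ler_wpM2l => //; rewrite lerXn2r ?nnegrE ?(ltW (r0 _)) ?(ltW M0).
    have h1 : expR (F * t) * m <= expR (F * t) * r (v 0 w) by rewrite ler_pM2l.
    have h2 : expR (F * t) * r (v 0 w) <= expR (F * t) * M by rewrite ler_pM2l.
    move=> /le_trans /(_ hb); set Sw := semigroup _ _ _ _ => hS.
    suff : expR (F * t) * m - `|C| * M ^+ 2 / N <= Sw <=
      expR (F * t) * M + `|C| * M ^+ 2 / N by [].
    by move: hS; rewrite ler_norml => /andP[h3 h4]; apply/andP; split; lra.
  have mS : measurable_fun setT (fun w =>
      (semigroup Q t (fun y => Num.min (f y) N) (Y 0 w))%:E).
    exact: (@discrete_measurable_fun R _ _ _ (Y 0)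
       (fun x => (semigroup Q t (fun y => Num.min (f y) N) x)%:E) (process_discrete (lexx 0))).
  have S0 w : (0 <= (semigroup Q t (fun y => Num.min (f y) N) (Y 0 w))%:E)%E.
    by rewrite lee_fin (semigroup_ge0 QP)// ltW.
  apply/andP; split.
    have [neg|pos] := leP (expR (F * t) * m - `|C| * M ^+ 2 / N) 0.
      by apply: (@le_trans _ _ 0%E); [rewrite lee_fin|apply: integral_ge0 => w _; exact: S0].
    rewrite -[leLHS]mule1 -(probability_setT P) -integral_cst//.
    apply: ae_ge0_le_integral => // [w _|w _|]; [by rewrite lee_fin ltW|exact: S0|].
    by apply: initial_ae => w /key/andP[+ _] _; rewrite lee_fin.
  rewrite -[leRHS]mule1 -(probability_setT P) -integral_cst//.
  apply: ae_ge0_le_integral => // [w _|w _|]; first exact: S0.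
    rewrite lee_fin addr_ge0//; last by rewrite divr_ge0// ltW.
    by rewrite mulr_ge0// ltW.
  by apply: initial_ae => w /key/andP[_ +] _; rewrite lee_fin.
have mf : measurable_fun setT (fun w => (f (Y t w))%:E).
  exact: (@discrete_measurable_fun R _ _ _ (Y t) (fun x => (f x)%:E)
    (process_discrete (ltW t0))).
have mfN N : measurable_fun setT (fun w => (Num.min (f (Y t w)) N)%:E).
  exact: (@discrete_measurable_fun R _ _ _ (Y t) (fun x => (Num.min (f x) N)%:E)
    (process_discrete (ltW t0))).
have mx : measurable_fun setT (fun w => (expo alpha (X t w))%:E).
  exact: (@process_measurable t (fun x => (expo alpha x)%:E) (ltW t0)).
have small e : 0 < e -> \forall n \near \oo, M < n%:R /\ `|C| * M ^+ 2 / n%:R <= e.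
  move=> e0; near=> n.
  have n1 : M < n%:R by near: n; exact: nbhs_infty_gtr.
  have n2 : `|C| * M ^+ 2 / e < n%:R by near: n; exact: nbhs_infty_gtr.
  split=> //; rewrite ler_pdivrMr ?(lt_trans M0)// [leRHS]mulrC -ler_pdivrMr//.
  exact: ltW.
have Ilow : ((expR (F * t) * m)%:E <= I)%E.
  apply/lee_addgt0Pr => e e0.
  have [n _ /(_ n (leqnn n))[Mn ne]] := small e e0.
  have /andP[h _] := INE _ Mn.
  rewrite -leeBlDr//; apply: (@le_trans _ _ (IN n%:R)).
    by apply: le_trans h; rewrite -EFinB lee_fin lerB.
  apply: ge0_le_integral => //.
    - by move=> w _; rewrite lee_fin le_min (ltW (f0 _)) (ltW (lt_trans M0 Mn)).
    - by move=> w _; rewrite lee_fin ge_min lexx.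
have Iup : (I <= (expR (F * t) * M)%:E)%E.
  apply/lee_addgt0Pr => e e0.
  have cv : IN n%:R @[n --> \oo] --> I.
    have := @cvg_monotone_convergence _ _ _ P setT measurableT
      (fun n w => (Num.min (f (Y t w)) n%:R)%:E) (fun n => mfN n%:R) _ _.
    rewrite (_ : (\int[P]_(x in _) _)%E = I).
      apply.
        by move=> n w _; rewrite lee_fin le_min (ltW (f0 _)) /=.
      move=> w _ n n' nn'; rewrite lee_fin le_min ge_min lexx/=.
      by rewrite ge_min ler_nat nn' orbT.
    apply: eq_integral => w _; apply: lim_near_cst => //.
    near=> n; congr (_%:E); apply: min_l; apply: ltW.
    by near: n; exact: nbhs_infty_gtr.
  rewrite -(cvg_lim _ cv)//; apply: lime_le; first by apply/cvg_ex; exists I.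
  near=> n; have [Mn ne] : M < n%:R /\ `|C| * M ^+ 2 / n%:R <= e.
    by near: n; exact: small.
  by have /andP[_ h] := INE _ Mn; apply: (le_trans h); rewrite -EFinD lee_fin lerD2l.
apply/andP; split.
- have : (I <= M%:E * \int[P]_w (expo alpha (X t w))%:E)%E.
    rewrite -ge0_integralZl//; last 2 first.
      by move=> w _; rewrite lee_fin ltW// expo_gt0.
      by rewrite lee_fin ltW.
    apply: ge0_le_integral => //.
    + by move=> w _; rewrite lee_fin ltW.
    + exact: measurable_funeM.
    + move=> w _; rewrite -EFinM lee_fin /f /expo_fct mulrC ler_wpM2r//.
      by rewrite ltW// expo_gt0.
  move=> /(le_trans Ilow); rewrite -lee_pdivrMl//; apply: le_trans.
  by rewrite -EFinM lee_fin le_eqVlt; apply/orP; left; apply/eqP; ring.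
- have : (m%:E * \int[P]_w (expo alpha (X t w))%:E <= I)%E.
    rewrite -ge0_integralZl//; last 2 first.
      by move=> w _; rewrite lee_fin ltW// expo_gt0.
      by rewrite lee_fin ltW.
    apply: ge0_le_integral => //.
    + by move=> w _; rewrite -EFinM lee_fin mulr_ge0// ltW// expo_gt0.
    + exact: measurable_funeM.
    + move=> w _; rewrite -EFinM lee_fin /f /expo_fct mulrC ler_wpM2l//.
      by rewrite ltW// expo_gt0.
  move=> /le_trans/(_ Iup); rewrite -lee_pdivlMl// => /le_trans; apply.
  by rewrite -EFinM lee_fin le_eqVlt; apply/orP; left; apply/eqP; ring.
Unshelve. all: by end_near.
Qed.

End Moments.

(** * Quadratic expansion of the logarithmic moment generating function *)

Section QuadExpansion.
Context {R : realType} {d : nat}.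
Implicit Types (a b g : 'rV[R]_d) (F : 'rV[R]_d -> R).

(** A quantitative differentiability at [a] with gradient [g]; the quadratic rate
    is what survives composition with the Perron root. *)
Definition quad_expansion F a g : Prop := exists2 C, 0 <= C &
  forall b, `|b| <= 1 -> `|F (a + b) - F a - dot b g| <= C * `|b| ^+ 2.

Definition onenorm g : R := \sum_i `|g 0 i|.

Lemma onenorm_ge0 g : 0 <= onenorm g. Proof. exact: sumr_ge0. Qed.

Lemma coord_le_norm b i : `|b 0 i| <= `|b|.
Proof.
rewrite [leRHS]/Num.norm /= mx_normrE.
by apply: (le_trans _ (le_bigmax _ _ (0, i))).
Qed.

Lemma dot_le_norm b g : `|dot b g| <= `|b| * onenorm g.
Proof.
rewrite /dot (le_trans (ler_norm_sum _ _ _))// /onenorm mulr_sumr.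
by apply: ler_sum => i _; rewrite normrM ler_wpM2r// coord_le_norm.
Qed.

Lemma quad_expansion_lipschitz F a g : quad_expansion F a g ->
  exists2 K, 0 <= K & forall b, `|b| <= 1 -> `|F (a + b) - F a| <= K * `|b|.
Proof.
move=> [C C0 hC]; exists (C + onenorm g); first by rewrite addr_ge0// onenorm_ge0.
move=> b b1; have := hC b b1; have := dot_le_norm b g.
have h : C * `|b| ^+ 2 <= C * `|b|.
  by apply: ler_wpM2l => //; rewrite expr2 ler_piMl.
have := ler_normD (F (a + b) - F a - dot b g) (dot b g).
rewrite subrK mulrDl; lra.
Qed.

Lemma quad_expansionZ k F a g : quad_expansion F a g ->
  quad_expansion (fun x => k * F x) a (k *: g).
Proof.
move=> [C C0 hC]; exists (`|k| * C) => [|b b1]; first exact: mulr_ge0.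
rewrite dotZr -!mulrBr normrM -mulrA; apply: ler_wpM2l => //; exact: hC.
Qed.

Lemma quad_expansionD F G a g h : quad_expansion F a g -> quad_expansion G a h ->
  quad_expansion (fun x => F x + G x) a (g + h).
Proof.
move=> [C C0 hC] [D D0 hD]; exists (C + D) => [|b b1]; first exact: addr_ge0.
rewrite dotDr mulrDl; apply: le_trans (lerD (hC b b1) (hD b b1)).
apply: le_trans (ler_normD _ _).
by rewrite le_eqVlt; apply/orP; left; apply/eqP; congr `|_|; ring.
Qed.

Lemma quad_expansion_sub_cst k F a g : quad_expansion F a g ->
  quad_expansion (fun x => F x - k) a g.
Proof.
move=> [C C0 hC]; exists C => // b b1; apply: le_trans (hC b b1).
by rewrite le_eqVlt; apply/orP; left; apply/eqP; congr `|_|; ring.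
Qed.

Lemma sqr_le_expR (x : R) : 0 <= x -> x ^+ 2 <= 4 * expR x.
Proof.
move=> x0; have h := expR_ge1Dx (x / 2).
have -> : expR x = expR (x / 2) ^+ 2.
  by rewrite -expRM_natl; congr expR; field.
have : (x / 2) ^+ 2 <= expR (x / 2) ^+ 2.
  by rewrite lerXn2r ?nnegrE ?expR_ge0 ?divr_ge0//; lra.
rewrite expr_div_n; lra.
Qed.

Lemma expR_dot_remainder b g : `|b| <= 1 ->
  `|expR (dot b g) - 1 - dot b g| <= 4 * expR (2 * onenorm g) * `|b| ^+ 2.
Proof.
move=> b1; apply: (le_trans (expR_remainder _)).
have n0 := onenorm_ge0 g; have h := dot_le_norm b g.
have h1 : `|dot b g| <= onenorm g by apply: (le_trans h); rewrite ler_piMl.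
have h2 : dot b g ^+ 2 <= `|b| ^+ 2 * (4 * expR (onenorm g)).
  apply: (@le_trans _ _ (`|b| ^+ 2 * onenorm g ^+ 2)).
    by rewrite -(real_normK (num_real (dot b g))) -exprMn lerXn2r ?nnegrE ?mulr_ge0.
  by apply: ler_wpM2l; [exact: sqr_ge0|exact: sqr_le_expR].
have h3 : expR `|dot b g| <= expR (onenorm g) by rewrite ler_expR.
have -> : 4 * expR (2 * onenorm g) * `|b| ^+ 2 =
    `|b| ^+ 2 * (4 * expR (onenorm g)) * expR (onenorm g).
  have -> : expR (2 * onenorm g) = expR (onenorm g) * expR (onenorm g).
    by rewrite -expRD; congr expR; ring.
  by ring.
by apply: ler_pM => //; exact: sqr_ge0.
Qed.

Lemma quad_expansion_expR g a :
  quad_expansion (fun x => expR (dot x g)) a (expR (dot a g) *: g).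
Proof.
exists (expR (dot a g) * (4 * expR (2 * onenorm g))) => [|b b1].
  by rewrite !mulr_ge0// expR_ge0.
rewrite dotDl expRD dotZr.
have -> : expR (dot a g) * expR (dot b g) - expR (dot a g) - expR (dot a g) * dot b g =
  expR (dot a g) * (expR (dot b g) - 1 - dot b g) by ring.
rewrite normrM ger0_norm ?expR_ge0// -!mulrA ler_wpM2l ?expR_ge0// mulrA.
exact: expR_dot_remainder.
Qed.

End QuadExpansion.

Section GammaExpansion.
Context {R : realType} {d : nat} (p : 'rV[int]_d -> R).
Hypothesis hp : prob_mass p.
Hypothesis hpexp : forall alpha : 'rV[R]_d,
    (\esum_(z in [set: 'rV[int]_d])
       (expR (dot alpha (real_vec z)) * p z)%:E < +oo)%E.

Let p0 z : 0 <= p z. Proof. by case: hp. Qed.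

Lemma rsummable_sum (S : choiceType) (I : Type) (s : seq I) (f : I -> S -> R) :
  (forall i, rsummable (f i)) -> rsummable (fun x => \sum_(i <- s) f i x).
Proof.
move=> sf; elim: s => [|i s IH].
  rewrite /rsummable esum1 ?ltry// => x _; by rewrite big_nil normr0.
rewrite (_ : (fun x => _) = (fun x => f i x + \sum_(j <- s) f j x)).
  exact: rsummableD.
by apply/funext => x; rewrite big_cons.
Qed.

Lemma rsum_sum (S : choiceType) (I : Type) (s : seq I) (f : I -> S -> R) :
  (forall i, rsummable (f i)) ->
  rsum (fun x => \sum_(i <- s) f i x) = \sum_(i <- s) rsum (f i).
Proof.
move=> sf; elim: s => [|i s IH].
  rewrite big_nil (_ : (fun x => _) = (fun=> 0)); last first.
    by apply/funext => x; rewrite big_nil.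
  by apply: EFin_inj; rewrite rsum_ge0E ?esum1// ltry.
rewrite big_cons -IH -rsumD//; last exact: rsummable_sum.
by congr rsum; apply/funext => x; rewrite big_cons.
Qed.

(** The weight [e ^ (2 |z|_1)] is one of the exponentials attached to the sign
    vectors, hence below their sum. *)
Lemma expR_onenorm_le (z : 'rV[int]_d) :
  expR (2 * onenorm (real_vec z : 'rV[R]_d)) <=
  \sum_(s : {ffun 'I_d -> bool}) expo (2 *: (\row_i (-1) ^+ s i : 'rV[R]_d)) z.
Proof.
pose s0 := [ffun i => real_vec z 0 i < 0 :> R] : {ffun 'I_d -> bool}.
rewrite (bigD1 s0)//= ler_wpDr ?sumr_ge0// => [s _|]; first exact/ltW/expo_gt0.
rewrite ler_expR dotZl ler_pM2l// /onenorm /dot; apply: ler_sum => i _.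
rewrite [X in _ <= X * _]mxE ffunE; case: ltP => h; last by rewrite mul1r ger0_norm.
by rewrite expr1 mulN1r ltr0_norm.
Qed.

Lemma expo_onenorm_summable a :
  rsummable (fun z => p z * expo a z * expR (2 * onenorm (real_vec z : 'rV[R]_d))).
Proof.
pose g (s : {ffun 'I_d -> bool}) z := p z * expo (a + 2 *: (\row_i (-1) ^+ s i)) z.
have sg : rsummable (fun z => \sum_s g s z).
  by apply: rsummable_sum => s; exact: expo_summable.
apply: rsummable_le sg => z.
rewrite ger0_norm ?mulr_ge0 ?(ltW (expo_gt0 _ _)) ?expR_ge0//.
apply: le_trans (ler_norm _).
rewrite /g (eq_bigr (fun s : {ffun 'I_d -> bool} =>
   p z * expo a z * expo (2 *: (\row_i (-1) ^+ s i : 'rV[R]_d)) z)) => [|s _]; last first.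
  by rewrite /expo dotDl expRD mulrA.
by rewrite -mulr_sumr ler_wpM2l ?expR_onenorm_le// mulr_ge0// ltW// expo_gt0.
Qed.

(** The expansion of [expR (dot b z)] is summed against [p z * expo a z]; its
    remainder is dominated by [|b|^2 e ^ (2 |z|_1)]. *)
Lemma Gamma_quad_expansion a : exists g, quad_expansion (Gamma p) a g.
Proof.
have wS := expo_onenorm_summable a.
pose w z := p z * expo a z * expR (2 * onenorm (real_vec z : 'rV[R]_d)).
have w0 z : 0 <= w z by rewrite /w !mulr_ge0 ?expR_ge0// ltW// expo_gt0.
have pe0 z : 0 <= p z * expo a z by rewrite mulr_ge0// ltW// expo_gt0.
have wfin : (\esum_(z in [set: 'rV[int]_d]) (w z)%:E < +oo)%E.
  by apply: le_lt_trans wS; apply: le_esum => z _; rewrite lee_fin ler_norm.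
have cS i : rsummable (fun z => p z * expo a z * (real_vec z : 'rV[R]_d) 0 i).
  apply: rsummable_le wfin => z; rewrite normrM ger0_norm// /w ler_wpM2l//.
  apply: (@le_trans _ _ (onenorm (real_vec z : 'rV[R]_d))).
    by rewrite /onenorm (bigD1 i)//= lerDl sumr_ge0.
  have := expR_ge1Dx (2 * onenorm (real_vec z : 'rV[R]_d)).
  have := onenorm_ge0 (real_vec z : 'rV[R]_d); lra.
pose g : 'rV[R]_d := \row_i rsum (fun z => p z * expo a z * (real_vec z : 'rV[R]_d) 0 i).
exists g, (4 * rsum w) => [|b b1]; first by apply: mulr_ge0 => //; exact: rsum_ge0.
have dS : rsummable (fun z => p z * expo a z * dot b (real_vec z)).
  rewrite (_ : (fun z => _) = (fun z => \sum_i b 0 i *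
      (p z * expo a z * (real_vec z : 'rV[R]_d) 0 i))).
    by apply: rsummable_sum => i; exact: rsummableZ.
  by apply/funext => z; rewrite /dot mulr_sumr; apply: eq_bigr => i _; ring.
have dE : dot b g = rsum (fun z => p z * expo a z * dot b (real_vec z)).
  rewrite (_ : (fun z => _) = (fun z => \sum_i b 0 i *
      (p z * expo a z * (real_vec z : 'rV[R]_d) 0 i))).
    rewrite rsum_sum => [|i]; last exact: rsummableZ.
    by apply: eq_bigr => i _; rewrite rsumZ// mxE.
  by apply/funext => z; rewrite /dot mulr_sumr; apply: eq_bigr => i _; ring.
have aS := @expo_summable _ _ p hp hpexp a.
have abS := @expo_summable _ _ p hp hpexp (a + b).
rewrite !(GammaE hp hpexp) dE.
rewrite (_ : _ - 1 - _ - _ = rsum (fun z => p z * expo (a + b) z)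
   + - rsum (fun z => p z * expo a z)
   + - rsum (fun z => p z * expo a z * dot b (real_vec z))); last by ring.
have n1 := rsummableN aS; have n2 := rsummableN dS; have n3 := rsummableD abS n1.
rewrite -(rsumN aS) -(rsumN dS) -(rsumD abS n1) -(rsumD n3 n2).
rewrite -mulrA [rsum w * _]mulrC mulrA -rsumZ//.
apply: ler_norm_rsum => [z|]; last first.
  by rewrite esumZr ?mulr_ge0 ?sqr_ge0// lte_mul_pinfty// lee_fin mulr_ge0 ?sqr_ge0.
rewrite (_ : _ + - _ + - _ = p z * expo a z *
   (expR (dot b (real_vec z)) - 1 - dot b (real_vec z))); last first.
  by rewrite /expo dotDl expRD; ring.
rewrite normrM ger0_norm// /w mulrC
  [leRHS](_ : _ = 4 * expR (2 * onenorm (real_vec z : 'rV[R]_d)) * `|b| ^+ 2 *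
    (p z * expo a z)).
  by rewrite ler_wpM2r// expR_dot_remainder.
ring.
Qed.

End GammaExpansion.

Section RootExpansion.
Context {R : realType} {d : nat} {V : {fset 'rV[int]_d}}.
Variables (lambda kappa gamma : R) (p : 'rV[int]_d -> R) (pi : V -> V -> R).
Hypotheses (hgamma : 0 < gamma).
Hypotheses (hp : prob_mass p) (hpi : forall v v', 0 <= pi v v').
Hypothesis hirr : irreducible_rates pi.
Hypothesis hpexp : forall alpha : 'rV[R]_d,
    (\esum_(z in [set: 'rV[int]_d])
       (expR (dot alpha (real_vec z)) * p z)%:E < +oo)%E.

Lemma psi_quad_expansion a (v : V) :
  exists g, quad_expansion (fun x => psi lambda kappa p x v) a g.
Proof.
have [g hg] := Gamma_quad_expansion hp hpexp a.
exists (kappa *: g + lambda *: (expR (dot a (real_vec (val v))) *: real_vec (val v))).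
apply: quad_expansionD; first exact: quad_expansionZ.
apply: quad_expansionZ; apply: quad_expansion_sub_cst; exact: quad_expansion_expR.
Qed.

(** The gradient is the average of those of [psi] under the probability [l r]. *)
Lemma root_quad_expansion (F : 'rV[R]_d -> R) (l r : 'rV[R]_d -> V -> R) a :
  (forall a, perron_triple (fk_kernel gamma pi (psi lambda kappa p a)) (F a) (l a) (r a)) ->
  exists g, quad_expansion F a g.
Proof.
move=> pt; have [g hg] := choice (psi_quad_expansion a).
have mk := fk_kernel_metzler (psi lambda kappa p a) hgamma hpi hirr.
have [C C0 hC] := perron_expansion mk (pt a).
have [l0 r0 _ _ lr] := pt a.
have exK (v : V) : exists K, 0 <= K /\ forall b, `|b| <= 1 ->
    `|psi lambda kappa p (a + b) v - psi lambda kappa p a v| <= K * `|b|.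
  by have [K] := quad_expansion_lipschitz (hg v); exists K.
have exQ (v : V) : exists Q, 0 <= Q /\ forall b, `|b| <= 1 ->
    `|psi lambda kappa p (a + b) v - psi lambda kappa p a v - dot b (g v)| <=
    Q * `|b| ^+ 2.
  by have [Q] := hg v; exists Q.
have [K hK] := choice exK; have [Q hQ] := choice exQ.
pose Ks := \sum_v K v; pose Qs := \sum_v Q v.
have Ks0 : 0 <= Ks by apply: sumr_ge0 => v _; case: (hK v).
have Qs0 : 0 <= Qs by apply: sumr_ge0 => v _; case: (hQ v).
exists (\sum_v (l a v * r a v) *: g v), (C * Ks ^+ 2 + Qs).
  by rewrite addr_ge0// mulr_ge0// sqr_ge0.
move=> b b1; pose D (v : V) := psi lambda kappa p (a + b) v - psi lambda kappa p a v.
have DK (v : V) : `|D v| <= Ks * `|b|.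
  apply: (le_trans ((hK v).2 b b1)); apply: ler_wpM2r => //.
  by rewrite /Ks (bigD1 v)//= lerDl sumr_ge0// => w _; case: (hK w).
have := hC D _ (F (a + b)) (l (a + b)) (r (a + b)) DK.
rewrite -fk_kernelD (_ : (fun v => _ + D v) = psi lambda kappa p (a + b)); last first.
  by apply/funext => v; rewrite /D; ring.
move=> /(_ (pt _)); rewrite exprMn mulrA => h1.
have dE : dot b (\sum_v (l a v * r a v) *: g v) = \sum_v (l a v * r a v) * dot b (g v).
  by elim/big_rec2 : _ => [|v x y _ <-]; rewrite ?dot0r// dotDr dotZr.
have h2 : `|\sum_v l a v * D v * r a v - dot b (\sum_v (l a v * r a v) *: g v)|
    <= Qs * `|b| ^+ 2.
  rewrite dE -sumrB (le_trans (ler_norm_sum _ _ _))//.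
  rewrite -[leRHS]mul1r -lr mulr_suml; apply: ler_sum => v _.
  have lr0 : 0 <= l a v * r a v by rewrite mulr_ge0// ltW.
  rewrite (_ : _ - _ = (l a v * r a v) * (D v - dot b (g v))); last by ring.
  rewrite normrM ger0_norm// ler_wpM2l// (le_trans ((hQ v).2 b b1))//.
  rewrite ler_wpM2r ?sqr_ge0// /Qs (bigD1 v)//= lerDl sumr_ge0// => w _.
  by case: (hQ w).
rewrite mulrDl; apply: le_trans (lerD h1 h2); apply: le_trans (ler_normD _ _).
by rewrite le_eqVlt; apply/orP; left; apply/eqP; congr `|_|; ring.
Qed.

End RootExpansion.

(** * Half-space covers and approximation by gradients *)

Section Convexity.
Context {R : realType} {d : nat}.
Implicit Types (a b g x y : 'rV[R]_d) (F : 'rV[R]_d -> R).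

Lemma dotC a b : dot a b = dot b a.
Proof. by apply: eq_bigr => i _; rewrite mulrC. Qed.

Lemma dotNr a b : dot a (- b) = - dot a b.
Proof. by rewrite -scaleN1r dotZr mulN1r. Qed.

Lemma dot_ge0 a : 0 <= dot a a.
Proof. by apply: sumr_ge0 => i _; rewrite -expr2 sqr_ge0. Qed.

Lemma coord_sqr_le_dot a i : a 0 i ^+ 2 <= dot a a.
Proof.
by rewrite expr2 /dot (bigD1 i)//= lerDl sumr_ge0// => j _; rewrite -expr2 sqr_ge0.
Qed.

Lemma dot_eq0 a : dot a a = 0 -> a = 0.
Proof.
move=> h; apply/rowP => i; rewrite mxE; apply/eqP; rewrite -sqrf_eq0 eq_le sqr_ge0 andbT.
by rewrite -[leRHS]h coord_sqr_le_dot.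
Qed.

Lemma continuous_dot a : continuous (fun x => dot a x).
Proof.
move=> x; apply: (@continuous_sum R _ _ _ (fun i (z : 'rV[R]_d) => a 0 i * z 0 i)) => i.
exact: (cvgM (cvg_cst (a 0 i)) (@coord_continuous R 1 d 0 i x)).
Qed.

Lemma continuous_dot_self : continuous (fun x => dot x x).
Proof.
move=> x; apply: (@continuous_sum R _ _ _ (fun i (z : 'rV[R]_d) => z 0 i * z 0 i)) => i.
exact: (cvgM (@coord_continuous R 1 d 0 i x) (@coord_continuous R 1 d 0 i x)).
Qed.

Definition signed_unit (sg : bool) (i : 'I_d) : 'rV[R]_d := (-1) ^+ sg *: delta_mx 0 i.

Lemma dot_signed_unit sg i x : dot (signed_unit sg i) x = (-1) ^+ sg * x 0 i.
Proof.
rewrite /signed_unit dotZl; congr (_ * _); rewrite /dot (bigD1 i)//= mxE !eqxx mul1r.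
by rewrite big1 ?addr0// => j ji; rewrite mxE (negbTE ji) andbF mul0r.
Qed.

Lemma norm_signed_unit_le1 sg i : `|signed_unit sg i| <= 1.
Proof.
rewrite normrZ normrX normrN1 expr1n mul1r /Num.norm /= mx_normrE.
apply/bigmax_leP; split => // -[j k] _ /=.
by rewrite mxE; case: (_ && _); rewrite ?normr1 ?normr0.
Qed.

Definition halfspace F (m : R) a : set 'rV[R]_d := [set x | m < dot a x - F a].

Lemma open_halfspace F m a : open (halfspace F m a).
Proof.
have -> : halfspace F m a = (fun x => dot a x) @^-1` [set y | m + F a < y].
  by apply/seteqP; split => x; rewrite /halfspace/= ltrBrDr.
by apply: open_comp; [move=> x _; exact: continuous_dot|exact: open_gt].
Qed.

Lemma compact_cube (M : R) : compact [set x : 'rV[R]_d | forall i, `|x 0 i| <= M].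
Proof.
have := @rV_compact R d (fun=> `[-M, M]%classic) (fun=> @segment_compact _ _ _).
congr compact; apply/seteqP; split => x /= h i; have := h i;
  by rewrite /= in_itv/= ler_norml.
Qed.

(** Far away, one of the half-spaces attached to the vectors [e_i], [- e_i]
    contains the point: this is exponential tightness. *)
Lemma finite_halfspace_cover F m (B : set 'rV[R]_d) : closed B ->
  (forall x, B x -> exists a, halfspace F m a x) ->
  exists s : seq 'rV[R]_d, forall x, B x -> exists2 a, a \in s & halfspace F m a x.
Proof.
move=> cB hB.
pose e := signed_unit.
(* Beyond this bound for a coordinate, [dot (e sg i) x - F (e sg i) > m]. *)
pose M := `|m| + \sum_i (`|F (e false i)| + `|F (e true i)|).
pose K := [set x : 'rV[R]_d | forall i, `|x 0 i| <= M].
have : compact (K `&` B) by apply: compact_closedI; [exact: compact_cube|exact: cB].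
rewrite compact_cover => /(_ 'rV[R]_d setT (halfspace F m)) [].
- by move=> a _; exact: open_halfspace.
- by move=> x [_ /hB[a ha]]; exists a.
move=> D _ hD.
exists (enum_fset D ++ [seq e sg i | sg <- [:: true; false], i <- enum 'I_d]) => x Bx.
have [Kx|nKx] := pselect (K x).
  have [a /= aD ha] := hD _ (conj Kx Bx).
  by exists a => //; rewrite mem_cat; apply/orP; left.
have [i hi] : exists i, M < `|x 0 i|.
  by apply: contrapT => /forallNP h; apply: nKx => i; rewrite leNgt; exact/negP.
pose sg := x 0 i < 0.
exists (e sg i).
  rewrite mem_cat; apply/orP; right; apply/allpairsP; exists (sg, i) => /=.
  by rewrite mem_enum; split => //; case: sg.
rewrite /halfspace/= dot_signed_unit.
have -> : (-1) ^+ sg * x 0 i = `|x 0 i|.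
  rewrite /sg; case: (ltP (x 0 i) 0) => h.
    by rewrite expr1 mulN1r ltr0_norm.
  by rewrite expr0 mul1r ger0_norm.
have h : `|F (e sg i)| <= \sum_i (`|F (e false i)| + `|F (e true i)|).
  rewrite (bigD1 i)//=; apply: ler_wpDr; first by apply: sumr_ge0 => j _; exact: addr_ge0.
  by case: sg; rewrite ?lerDl ?lerDr.
move: hi; rewrite /M; have := ler_norm m; have := ler_norm (F (e sg i)); lra.
Qed.

Lemma locally_lipschitz_continuous (U : normedModType R) (F : U -> R) (a : U) (K : R) :
  0 <= K -> (forall b : U, `|b| <= 1 -> `|F (a + b) - F a| <= K * `|b|) ->
  {for a, continuous F}.
Proof.
move=> K0 hK; apply/cvgrPdist_lt => e e0.
have eK : 0 < e / (K + 1) by rewrite divr_gt0// ltr_wpDl.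
apply/nbhs_ballP; exists (Num.min 1 (e / (K + 1))); first by rewrite /= lt_min ltr01.
move=> b; rewrite -ball_normE /= lt_min distrC => /andP[/ltW h1 h2].
rewrite distrC; have := hK _ h1; rewrite [a + _]addrC subrK => /le_lt_trans; apply.
move: h2; rewrite ltr_pdivlMr ?ltr_wpDl//; have := normr_ge0 (b - a); lra.
Qed.

Lemma quad_expansion_continuous F :
  (forall a, exists g, quad_expansion F a g) -> continuous F.
Proof.
move=> hF a; have [g hg] := hF a; have [K K0 hK] := quad_expansion_lipschitz hg.
exact: locally_lipschitz_continuous hK.
Qed.

Lemma continuous_penalised (T : topologicalType) (f1 f2 f3 : T -> R) (k : R) :
  continuous f1 -> continuous f2 -> continuous f3 ->
  continuous (fun z => f1 z - f2 z - k * f3 z).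
Proof.
move=> c1 c2 c3 z.
exact: (cvgB (cvgB (c1 z) (c2 z)) (cvgM (cvg_cst k) (c3 z))).
Qed.

(** At a maximiser [a] of [dot b x - F b - eps / 2 * dot b b] the gradient of [F] is
    [g = x - eps a].  Comparing with [b = 0] bounds the penalty, hence the distance
    of [g] to [x]; and [dot a g - F a = dot a x - F a - eps * dot a a] is at most
    the value at [a] of the unpenalised objective. *)
Lemma gradient_approx F x (i rho : R) : (forall a, exists g, quad_expansion F a g) ->
  (forall a, dot a x - F a <= i) -> 0 < rho ->
  exists a g, [/\ quad_expansion F a g, dot a g - F a <= i &
    forall j, `|x 0 j - g 0 j| < rho].
Proof.
move=> hF hi rho0; pose D := i + F 0.
have D0 : 0 <= D by have := hi 0; rewrite dot0l /D; lra.
(* The penalty at the maximiser is at most [D], so [|eps a|^2 <= 2 eps D], which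
   this choice makes smaller than [rho ^ 2]. *)
pose eps := rho ^+ 2 / (4 * (D + 1)).
have eps0 : 0 < eps by rewrite divr_gt0 ?exprn_gt0// mulr_gt0// ltr_wpDl.
have epsE : 4 * (eps * (D + 1)) = rho ^+ 2.
  by rewrite /eps; field; rewrite gt_eqF// ltr_wpDl.
clearbody eps.
pose H b := dot b x - F b - eps / 2 * dot b b.
(* Beyond this squared radius the penalty brings [H] below its value at [0]. *)
pose Rad := 2 * (D + 1) / eps.
have Rad0 : 0 <= Rad by apply: divr_ge0; [apply: mulr_ge0 => //; exact: addr_ge0|exact: ltW].
pose K := [set b : 'rV[R]_d | dot b b <= Rad].
have cK : compact K.
  apply: (@subclosed_compact _ _ [set b : 'rV[R]_d | forall j, `|b 0 j| <= Rad + 1]).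
  - apply: (@preimage_closed _ _ (fun b : 'rV[R]_d => dot b b) [set y | y <= Rad]).
      by move=> b _; exact: continuous_dot_self.
    exact: closed_le.
  - exact: compact_cube.
  - move=> b /= bR j; have := coord_sqr_le_dot b j; rewrite -real_normK ?num_real// => h.
    have := normr_ge0 (b 0 j); have [//|h1 h2] := leP `|b 0 j| (Rad + 1).
    have : `|b 0 j| ^+ 2 <= Rad by apply: le_trans bR.
    have : `|b 0 j| <= `|b 0 j| ^+ 2 by rewrite expr2 ler_peMr//; lra.
    lra.
have cH : continuous H.
  have c1 : continuous (fun z => dot z x).
    rewrite (_ : (fun z => dot z x) = dot x); first exact: continuous_dot.
    by apply/funext => z; rewrite dotC.
  exact: (continuous_penalised (k := eps / 2) c1 (quad_expansion_continuous hF)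
    continuous_dot_self).
have K0 : K 0 by rewrite /K/= dot0l.
have [a /set_mem aK amax] := @compact_EVT_max _ R H K (ex_intro _ _ K0) cK
  (continuous_subspaceT cH).
have H0 : H 0 = - F 0 by rewrite /H !dot0l; ring.
have Ha b : H b <= H a.
  have [bR|bR] := leP (dot b b) Rad; first by apply: amax; exact/mem_set.
  apply: (@le_trans _ _ (H 0)); last by apply: amax; exact/mem_set.
  rewrite H0 /H; have := hi b.
  have : eps / 2 * Rad <= eps / 2 * dot b b by rewrite ler_pM2l ?divr_gt0// ltW.
  rewrite (_ : eps / 2 * Rad = D + 1); last by rewrite /Rad; field; rewrite gt_eqF.
  rewrite /D; lra.
have [g hg] := hF a; have [C C0 hC] := hg.
have [h hE] : exists h, h = x - g - eps *: a by exists (x - g - eps *: a).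
have hh : dot h h = dot h x - dot h g - eps * dot h a.
  by rewrite {2}hE !(dotDr, dotNr, dotZr).
(* First-order condition: moving from [a] by [s h] changes [H] by
   [s * dot h h] up to a term of order [s ^ 2]. *)
have h0 : dot h h = 0.
  apply/eqP; rewrite eq_le dot_ge0 andbT; apply/ler_addgt0Pr => e e0; rewrite add0r.
  pose C' := C * `|h| ^+ 2 + eps / 2 * dot h h + 1.
  have C'0 : 0 < C'.
    by rewrite /C' ltr_wpDl// addr_ge0// mulr_ge0 ?sqr_ge0 ?dot_ge0// divr_ge0// ltW.
  have N0 : 0 < `|h| + 1 by rewrite ltr_wpDl.
  pose s := Num.min (e / C') (`|h| + 1)^-1.
  have s0 : 0 < s by rewrite lt_min divr_gt0//= invr_gt0.
  have sh : `|s *: h| = s * `|h| by rewrite normrZ gtr0_norm.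
  have sh1 : `|s *: h| <= 1.
    rewrite sh; apply: (@le_trans _ _ ((`|h| + 1)^-1 * `|h|)).
      by rewrite ler_wpM2r// ge_min lexx orbT.
    by rewrite ler_pdivrMl// mulr1 lerDl.
  have := Ha (a + s *: h); have := hC _ sh1; rewrite sh ler_norml => /andP[_].
  rewrite /H !(dotDl, dotDr, dotZl, dotZr) (dotC a h) exprMn => h1 h2.
  have h3 : s * dot h h <= s * (s * C').
    have : s * dot h h = s * dot h x - s * dot h g - s * (eps * dot h a) by rewrite hh; ring.
    have : s * (s * C') = C * (s ^+ 2 * `|h| ^+ 2) + eps / 2 * (s * (s * dot h h)) + s * s.
      by rewrite /C'; ring.
    have := mulr_ge0 (ltW s0) (ltW s0); lra.
  move: h3; rewrite ler_pM2l// => /le_trans; apply.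
  by rewrite -ler_pdivlMr// ge_min lexx.
have gE : g = x - eps *: a.
  move: hE; rewrite (dot_eq0 h0) => /esym/eqP; rewrite addrAC subr_eq0 => /eqP ->//.
have aa : eps / 2 * dot a a <= D.
  have := Ha 0; rewrite H0 /H; have := hi a; rewrite /D; lra.
exists a, g; split => //.
- rewrite gE dotDr dotNr dotZr; have := hi a.
  have : 0 <= eps * dot a a by rewrite mulr_ge0 ?dot_ge0// ltW.
  lra.
- move=> j; rewrite gE !mxE opprB addrC subrK.
  rewrite -(ltr_pXn2r (n := 2)) ?nnegrE ?(ltW rho0)// real_normK ?num_real//.
  rewrite exprMn; apply: (@le_lt_trans _ _ (eps ^+ 2 * dot a a)).
    by rewrite ler_wpM2l ?sqr_ge0// coord_sqr_le_dot.
  have : eps * (eps / 2 * dot a a) <= eps * D by rewrite ler_pM2l.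
  have : 0 < rho ^+ 2 by rewrite exprn_gt0.
  lra.
Qed.

End Convexity.

(** * Large deviation bounds *)

Section ExtendedReals.
Context {R : realType}.

Lemma lee_real_above (x y : \bar R) : (forall r : R, x < r%:E -> y <= r%:E)%E -> (y <= x)%E.
Proof.
move=> h; case: x h => [x| |] h.
- by apply/lee_addgt0Pr => e e0; rewrite -EFinD; apply: h; rewrite lte_fin ltrDl.
- exact: leey.
- case: y h => [y| |] h.
  + by have := h (y - 1)%R (ltNyr _); rewrite lee_fin => yy; exfalso; lra.
  + by have := h 0%R (ltNyr _).
  + exact: lexx.
Qed.

Lemma limf_esup_le (f : R -> \bar R) (y : \bar R) :
  (\forall t \near +oo, (f t <= y)%E) -> (limf_esup f (pinfty_nbhs R) <= y)%E.
Proof.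
move=> fy; apply: (@le_trans _ _ (ereal_sup (f @` [set t | (f t <= y)%E]))).
  by apply: ereal_inf_lbound; exists [set t | (f t <= y)%E].
by apply: ge_ereal_sup => _ [t ft <-].
Qed.

Lemma limf_einf_ge (f : R -> \bar R) (y : \bar R) :
  (\forall t \near +oo, (y <= f t)%E) -> (y <= limf_einf f (pinfty_nbhs R))%E.
Proof.
move=> fy; rewrite /limf_einf leeNr; apply: limf_esup_le.
by apply: filterS fy => t; rewrite leeN2.
Qed.

Lemma near_log_le (K m y : R) : 0 < K -> m < y ->
  \forall t \near +oo, 0 < t /\ t^-1 * ln (K * expR (t * m)) <= y.
Proof.
move=> K0 my; have ym : 0 < y - m by rewrite subr_gt0.
near=> t; have t0 : 0 < t by near: t; apply: nbhs_pinfty_gt; exact: num_real.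
have tK : ln K / (y - m) < t by near: t; apply: nbhs_pinfty_gt; exact: num_real.
split=> //; rewrite lnM ?posrE ?expR_gt0// expRK mulrDr mulKf ?gt_eqF//.
rewrite -lerBrDr ler_pdivrMl//; move: tK; rewrite ltr_pdivrMr//; exact: ltW.
Unshelve. all: by end_near.
Qed.

Lemma near_log_ge (K m y : R) : 0 < K -> y < m ->
  \forall t \near +oo, 0 < t /\ y <= t^-1 * ln (K * expR (t * m)).
Proof.
move=> K0 my; have ym : 0 < m - y by rewrite subr_gt0.
near=> t; have t0 : 0 < t by near: t; apply: nbhs_pinfty_gt; exact: num_real.
have tK : - ln K / (m - y) < t by near: t; apply: nbhs_pinfty_gt; exact: num_real.
split=> //; rewrite lnM ?posrE ?expR_gt0// expRK mulrDr mulKf ?gt_eqF//.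
rewrite -lerBlDr ler_pdivlMl//; move: tK; rewrite ltr_pdivrMr//; lra.
Unshelve. all: by end_near.
Qed.

End ExtendedReals.

Section GartnerEllis.
Context {R : realType} {n : nat} {dO : measure_display}
  {Omega : measurableType dO} (P : probability Omega R).
Variables (Z : R -> Omega -> 'rV[R]_n) (F : 'rV[R]_n -> R) (c C : 'rV[R]_n -> R).
Implicit Types (a b g x y : 'rV[R]_n) (A B G : set 'rV[R]_n).

Hypothesis mZ : forall t, 0 < t -> forall A, measurable (Z t @^-1` A).
Hypotheses (c0 : forall a, 0 < c a) (C0 : forall a, 0 < C a).
Hypothesis mgf : forall a t, 0 < t ->
  ((c a * expR (F a * t))%:E <= \int[P]_w (expR (t * dot a (Z t w)))%:E <=
   (C a * expR (F a * t))%:E)%E.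
Hypothesis Fquad : forall a, exists g, quad_expansion F a g.

Let mgf_measurable t a : 0 < t ->
  measurable_fun setT (fun w => (expR (t * dot a (Z t w)))%:E).
Proof.
move=> t0 _ B mB; rewrite setTI.
exact: (mZ t0 ((fun z => (expR (t * dot a z))%:E) @^-1` B)).
Qed.

Lemma integral_exponential_le (u : Omega -> R) t (I : Type) (s : seq I)
    (k : I -> R) (a : I -> 'rV[R]_n) : 0 < t ->
  measurable_fun setT (fun w => (u w)%:E) ->
  (forall w, 0 <= u w) -> (forall i, 0 <= k i) ->
  (forall w, u w <= \sum_(i <- s) k i * expR (t * dot (a i) (Z t w))) ->
  (\int[P]_w (u w)%:E <= (\sum_(i <- s) k i * (C (a i) * expR (F (a i) * t)))%:E)%E.
Proof.
move=> t0 mu u0 k0 uk.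
have mk i : measurable_fun setT (fun w => ((k i)%:E * (expR (t * dot (a i) (Z t w)))%:E)%E).
  exact/measurable_funeM/mgf_measurable.
have k00 i w : (0 <= (k i)%:E * (expR (t * dot (a i) (Z t w)))%:E)%E.
  by rewrite mule_ge0// lee_fin// expR_ge0.
apply: (@le_trans _ _ (\int[P]_w \sum_(i <- s) (k i)%:E * (expR (t * dot (a i) (Z t w)))%:E)%E).
  apply: ge0_le_integral => //.
  - by move=> w _; rewrite lee_fin.
  - exact: emeasurable_sum.
  - by move=> w _; rewrite sumEFin lee_fin.
rewrite ge0_integral_sum// -sumEFin; apply: lee_sum => i _.
have e0 w : setT w -> (0 <= (expR (t * dot (a i) (Z t w)))%:E)%E.
  by move=> _; rewrite lee_fin expR_ge0.
rewrite (ge0_integralZl P measurableT (mgf_measurable (a i) t0) e0) ?lee_fin//.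
by rewrite EFinM lee_wpmul2l ?lee_fin//; have /andP[] := mgf (a i) t0.
Qed.

(** The exponential Chebyshev inequality on each of finitely many half-spaces. *)
Lemma ldp_upper B : closed B ->
  (limf_esup (fun t : R => t^-1%:E * lne (P [set w | B (Z t w)])) (pinfty_nbhs R)
     <= - ereal_inf (legendre F @` B))%E.
Proof.
move=> cB; apply: lee_real_above => y.
rewrite lteNl -EFinN => yJ.
have [m [ym mJ]] : exists m, - y < m /\ (m%:E < ereal_inf (legendre F @` B))%E.
  case: (ereal_inf _) yJ => [j| |] // yj.
    by exists ((- y + j) / 2); move: yj; rewrite !lte_fin => yj; split; lra.
  by exists (- y + 1); split; [lra|exact: ltry].
have [s hs] : exists s : seq 'rV[R]_n, forall x, B x ->
    exists2 a, a \in s & halfspace F m a x.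
  apply: finite_halfspace_cover => // x Bx.
  have : (m%:E < legendre F x)%E.
    by apply: lt_le_trans mJ _; apply: ereal_inf_lbound; exists x.
  by move=> /ereal_sup_gt[_ [a _ <-]]; rewrite lte_fin => h; exists a.
pose K := 1 + \sum_(a <- s) C a.
have K0 : 0 < K by rewrite ltr_pwDl// sumr_ge0// => a _; exact: ltW.
apply: limf_esup_le.
have my : - m < y by lra.
apply: filterS (near_log_le K0 my) => t [t0 ht].
have mB : measurable [set w | B (Z t w)] by exact: mZ.
have PB : (P [set w | B (Z t w)] <= (K * expR (t * - m))%:E)%E.
  rewrite -[X in P X]setIT -integral_indic//.
  apply: le_trans (@integral_exponential_le _ t _ s
    (fun a => expR (- t * (m + F a))) id t0 _ _ _ _) _.
  - exact/measurable_EFinP/measurable_indic.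
  - by move=> w; rewrite indicE.
  - by move=> a; exact: expR_ge0.
  - move=> w; rewrite indicE; case: (boolP (w \in _)) => [/set_mem/= /hs[a sa ha]|_] /=.
      rewrite (big_rem _ sa)/=; apply: ler_wpDr.
        by apply: sumr_ge0 => b _; rewrite mulr_ge0 ?expR_ge0.
      rewrite -expRD -[leLHS]expR0 ler_expR mulNr addrC -mulrBr mulr_ge0 ?(ltW t0)//.
      by move: ha; rewrite /halfspace/=; lra.
    by rewrite sumr_ge0// => a _; rewrite mulr_ge0 ?expR_ge0.
  - rewrite lee_fin /K mulrDl ler_wpDl ?mulr_ge0 ?expR_ge0// mulr_suml.
    apply: ler_sum => a _; rewrite mulrCA -expRD ler_wpM2l ?(ltW (C0 _))//.
    by rewrite le_eqVlt; apply/orP; left; apply/eqP; congr expR; ring.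
have [P0|Pn0] := eqVneq (P [set w | B (Z t w)]) 0%E.
  by rewrite P0 le0_lneNy// gt0_muleNy ?leNye// lte_fin invr_gt0.
apply: le_trans (_ : (t^-1%:E * (ln (K * expR (t * - m)))%:E <= _)%E); last first.
  by rewrite -EFinM lee_fin.
rewrite lee_wpmul2l ?lee_fin ?invr_ge0 ?(ltW t0)//.
have Kp : 0 < K * expR (t * - m) by rewrite mulr_gt0// expR_gt0.
rewrite -(lne_EFin Kp) lee_lne// in_itv/= ?leey ?andbT ?lee_fin ?(ltW Kp)//.
Qed.

(** Under the measure tilted by [a] the process concentrates at the gradient [g]:
    leaving the cube around [g] through a given face costs a further tilt along
    that face, whose first-order effect is compensated by the definition of [g]. *)
Lemma tilted_lower_bound a g G (delta : R) : quad_expansion F a g -> 0 < delta ->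
  (forall z : 'rV[R]_n, (forall j, `|z 0 j - g 0 j| < delta) -> G z) ->
  \forall t \near +oo, 0 < t /\ ((c a / 2 *
     expR (t * (F a - dot a g - onenorm a * delta)))%:E <= P [set w | G (Z t w)])%E.
Proof.
move=> [D D0 hD] delta0 Gcube.
(* The quadratic remainder of [F] along a step [s] then costs at most half of the
   gain [s * delta] of the Chebyshev inequality. *)
pose s := Num.min 1 (delta / (2 * (D + 1))).
have D10 : 0 < 2 * (D + 1) by rewrite mulr_gt0// ltr_wpDl.
have s0 : 0 < s by rewrite lt_min ltr01 divr_gt0.
have s1 : s <= 1 by rewrite ge_min lexx.
have sD : D * s <= delta / 2.
  have : s * (2 * (D + 1)) <= delta by rewrite -ler_pdivlMr// ge_min lexx orbT.
  lra.
pose I := (bool * 'I_n)%type.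
pose b (p : I) := s *: signed_unit p.1 p.2 : 'rV[R]_n.
have Fb p : F (a + b p) <= F a + s * ((-1) ^+ p.1 * g 0 p.2) + s * (delta / 2).
  have nb : `|b p| <= s by rewrite normrZ gtr0_norm// ler_piMr ?norm_signed_unit_le1// ltW.
  have := hD _ (le_trans nb s1); rewrite dotZl dot_signed_unit ler_norml => /andP[_].
  have h1 : D * `|b p| ^+ 2 <= D * s ^+ 2.
    by rewrite ler_wpM2l// lerXn2r ?nnegrE ?(ltW s0).
  have h2 : s * (D * s) <= s * (delta / 2) by rewrite ler_pM2l.
  lra.
pose K := 1 + \sum_(p : I) C (a + b p).
have K0 : 0 < K by rewrite ltr_pwDl// sumr_ge0// => p _; exact: ltW.
pose h := s * (delta / 2).
have h0 : 0 < h by rewrite mulr_gt0// divr_gt0.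
pose M := dot a g + onenorm a * delta.
near=> t; have t0 : 0 < t by near: t; apply: nbhs_pinfty_gt; exact: num_real.
have tK : ln (2 * K / c a) / h < t by near: t; apply: nbhs_pinfty_gt; exact: num_real.
split=> //.
pose A := [set z : 'rV[R]_n | forall j, `|z 0 j - g 0 j| < delta].
have mA : measurable (Z t @^-1` A) by exact: mZ.
have mG : measurable [set w | G (Z t w)] by exact: (mZ t0 G).
apply: (@le_trans _ _ (P (Z t @^-1` A))); last first.
  by apply: le_measure; rewrite ?inE//; move=> w; exact: Gcube.
pose u w := expR (t * dot a (Z t w)) * \1_(~` (Z t @^-1` A)) w.
have mu : measurable_fun setT (fun w => (u w)%:E).
  apply/measurable_EFinP; apply: measurable_funM.
    by apply/measurable_EFinP; exact: mgf_measurable.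
  by apply: measurable_indic; exact: measurableC.
have u0 w : 0 <= u w by rewrite mulr_ge0 ?expR_ge0// indicE.
pose k (p : I) := expR (- (t * (s * ((-1) ^+ p.1 * g 0 p.2 + delta)))).
have escape : (\int[P]_w (u w)%:E <= (K * expR (t * (F a - h)))%:E)%E.
  apply: le_trans (@integral_exponential_le _ t I (index_enum _) k
    (fun p => a + b p) t0 mu u0 _ _) _.
  - by move=> p; exact: expR_ge0.
  - move=> w; rewrite /u indicE; case: (boolP (w \in _)) => [/set_mem/= nA|_] /=; last first.
      by rewrite mulr0 sumr_ge0// => p _; rewrite mulr_ge0 ?expR_ge0.
    rewrite mulr1; have [j hj] : exists j, delta <= `|Z t w 0 j - g 0 j|.
      by apply: contrapT => /forallNP hn; apply: nA => j; rewrite ltNge; exact/negP.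
    pose sg := Z t w 0 j < g 0 j.
    have {}hj : delta <= (-1) ^+ sg * Z t w 0 j - (-1) ^+ sg * g 0 j.
      rewrite -mulrBr /sg; move: hj; case: (ltP (Z t w 0 j) (g 0 j)) => zg.
        by rewrite expr1 mulN1r ltr0_norm// subr_lt0.
      by rewrite expr0 mul1r ger0_norm// subr_ge0.
    rewrite (bigD1 (sg, j))//=; apply: ler_wpDr.
      by apply: sumr_ge0 => p _; rewrite mulr_ge0 ?expR_ge0.
    rewrite /k -expRD ler_expR /b dotDl dotZl dot_signed_unit /= -subr_ge0.
    rewrite (_ : _ - _ = t * (s * ((-1) ^+ sg * Z t w 0 j - (-1) ^+ sg * g 0 j - delta))).
      by apply: mulr_ge0 (ltW t0) (mulr_ge0 (ltW s0) _); rewrite subr_ge0.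
    by ring.
  - rewrite lee_fin /K mulrDl ler_wpDl ?mulr_ge0 ?expR_ge0// mulr_suml.
    apply: ler_sum => p _; rewrite mulrCA -expRD ler_wpM2l ?(ltW (C0 _))//.
    rewrite ler_expR; have := Fb p; rewrite -(ler_pM2l t0) /h; lra.
have inside : (\int[P]_w (expR (t * dot a (Z t w)))%:E <=
    (expR (t * M))%:E * P (Z t @^-1` A) + \int[P]_w (u w)%:E)%E.
  have mI : measurable_fun setT (fun w => (\1_(Z t @^-1` A) w : R)%:E).
    exact/measurable_EFinP/measurable_indic.
  have I0 w : setT w -> (0 <= (\1_(Z t @^-1` A) w : R)%:E)%E.
    by move=> _; rewrite lee_fin indicE.
  have <- : (\int[P]_w ((expR (t * M))%:E * (\1_(Z t @^-1` A) w)%:E) =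
      (expR (t * M))%:E * P (Z t @^-1` A))%E.
    rewrite (ge0_integralZl P measurableT mI I0) ?lee_fin ?expR_ge0//.
    by rewrite integral_indic// setIT.
  have mi : measurable_fun setT
      (fun w => ((expR (t * M))%:E * (\1_(Z t @^-1` A) w)%:E)%E).
    exact: measurable_funeM.
  have i0 w : setT w -> (0 <= (expR (t * M))%:E * (\1_(Z t @^-1` A) w)%:E)%E.
    by move=> _; rewrite mule_ge0// lee_fin ?expR_ge0// indicE.
  have u0' w : setT w -> (0 <= (u w)%:E)%E by rewrite lee_fin.
  rewrite -(ge0_integralD P measurableT i0 mi u0' mu).
  apply: ge0_le_integral => //.
  - exact: mgf_measurable.
  - exact: emeasurable_funD.
  move=> w _; rewrite -EFinM -EFinD lee_fin /u !indicE in_setC.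
  case: (boolP (w \in _)) => [/set_mem/= wA|_] /=; last by rewrite mulr0 mulr1 add0r.
  rewrite mulr1 mulr0 addr0 ler_expR ler_pM2l// /M -{1}(subrK g (Z t w)) addrC dotDr lerD2l.
  apply: (le_trans (ler_norm _)); rewrite /dot (le_trans (ler_norm_sum _ _ _))//.
  rewrite /onenorm mulr_suml; apply: ler_sum => j _; rewrite normrM ler_wpM2l// !mxE.
  exact/ltW/wA.
have [q PA q0] : exists2 q, P (Z t @^-1` A) = q%:E & 0 <= q.
  exists (fine (P (Z t @^-1` A))); last exact: fine_ge0.
  by rewrite fineK// fin_num_measure.
have /andP[low _] := mgf a t0.
have := le_trans low (le_trans inside (leeD (lexx _) escape)).
rewrite PA -EFinM -EFinD !lee_fin => main.
have small : K * expR (t * (F a - h)) <= c a / 2 * expR (F a * t).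
  have -> : K * expR (t * (F a - h)) = K * expR (- (t * h)) * expR (F a * t).
    by rewrite -mulrA -expRD; congr (_ * expR _); ring.
  rewrite ler_wpM2r ?expR_ge0//.
  have cK : 0 < 2 * K / c a by rewrite divr_gt0// mulr_gt0.
  have : expR (- (t * h)) <= expR (- ln (2 * K / c a)).
    by rewrite ler_expR lerN2 -ler_pdivrMr// ltW.
  have -> : expR (- ln (2 * K / c a)) = c a / (2 * K).
    by rewrite expRN lnK ?posrE// invf_div.
  move=> /(ler_wpM2l (ltW K0)) /le_trans; apply.
  by rewrite le_eqVlt; apply/orP; left; apply/eqP; field; rewrite !gt_eqF.
have : c a / 2 * expR (F a * t) <= expR (t * M) * q by lra.
rewrite (_ : F a - dot a g - onenorm a * delta = F a - M); last by rewrite /M; ring.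
rewrite mulrBr expRD expRN mulrA ler_pdivrMr ?expR_gt0// [t * F a]mulrC.
by rewrite [q * _]mulrC.
Unshelve. all: by end_near.
Qed.

(** It suffices to bound the probability of a small cube around a gradient, and
    gradients approximate in position and rate every point of finite rate. *)
Lemma ldp_lower G : open G ->
  (- ereal_inf (legendre F @` G) <=
     limf_einf (fun t : R => t^-1%:E * lne (P [set w | G (Z t w)])) (pinfty_nbhs R))%E.
Proof.
move=> oG; rewrite leeNl; apply: le_ereal_inf_tmp => _ [x Gx <-].
rewrite leeNl.
have F0 : ((- F 0)%:E <= legendre F x)%E.
  by apply: ereal_sup_ubound; exists 0 => //; rewrite dot0l add0r.
case E : (legendre F x) F0 => [i| |] F0; [|by rewrite leNye|by []].
rewrite -EFinN; apply/lee_subgt0Pr => e e0; rewrite -EFinB.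
have hi b : dot b x - F b <= i.
  by rewrite -lee_fin -E; apply: ereal_sup_ubound; exists b.
have [rho /= rho0 rhoG] := (nbhs_ballP x G).1 (open_nbhs_nbhs (conj oG Gx)).
have r20 : 0 < rho / 2 by rewrite divr_gt0.
have [a [g [Fag ig gx]]] := gradient_approx Fquad hi r20.
have N0 : 0 < onenorm a + 1 by rewrite ltr_wpDl// onenorm_ge0.
pose delta := Num.min (rho / 2) (e / 2 / (onenorm a + 1)).
have delta0 : 0 < delta by rewrite lt_min r20 divr_gt0// divr_gt0.
have Gcube (z : 'rV[R]_n) : (forall j, `|z 0 j - g 0 j| < delta) -> G z.
  move=> zg; apply: rhoG; rewrite -ball_normE /ball_ /=.
  rewrite /Num.norm /= mx_normrE; apply/bigmax_ltP; split => // -[i1 j] _ /=.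
  rewrite ord1 !mxE; have := gx j; have := zg j; rewrite lt_min => /andP[h1 _] h2.
  have := ler_normD (x 0 j - g 0 j) (g 0 j - z 0 j).
  rewrite addrA subrK (distrC (g 0 j)) => h3; lra.
have ed : onenorm a * delta <= e / 2.
  have : delta * (onenorm a + 1) <= e / 2 by rewrite -ler_pdivlMr// ge_min lexx orbT.
  lra.
apply: limf_einf_ge.
have ca : 0 < c a / 2 by rewrite divr_gt0.
pose m := F a - dot a g - onenorm a * delta.
have my : - i - e < m by rewrite /m; lra.
near=> t.
have [t0 tP] : 0 < t /\ ((c a / 2 * expR (t * m))%:E <= P [set w | G (Z t w)])%E.
  by near: t; exact: tilted_lower_bound.
have [_ tl] : 0 < t /\ - i - e <= t^-1 * ln (c a / 2 * expR (t * m)).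
  by near: t; exact: near_log_ge.
have Kp : 0 < c a / 2 * expR (t * m) by rewrite mulr_gt0// expR_gt0.
apply: (@le_trans _ _ (t^-1%:E * (ln (c a / 2 * expR (t * m)))%:E)%E).
  by rewrite -EFinM lee_fin.
rewrite lee_wpmul2l ?lee_fin ?invr_ge0 ?(ltW t0)// -(lne_EFin Kp).
by rewrite lee_lne// in_itv/= ?leey ?andbT ?lee_fin ?(ltW Kp).
Unshelve. all: by end_near.
Qed.

End GartnerEllis.

(** * Conclusion *)

Section Assembly.
Context {R : realType}.

(** Only the exponential rate survives after dividing the logarithm by [t]. *)
Lemma log_cvg (E : R -> \bar R) (F c C : R) : 0 < c -> 0 < C ->
  (forall t, 0 < t -> ((c * expR (F * t))%:E <= E t <= (C * expR (F * t))%:E)%E) ->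
  ((t^-1)%:E * lne (E t))%E @[t --> +oo] --> F%:E.
Proof.
move=> c0 C0 hE.
have pos (k t : R) : 0 < k -> 0 < k * expR (F * t) by move=> k0; rewrite mulr_gt0// expR_gt0.
have [x xE] : exists x : R -> R, forall t, 0 < t ->
    E t = (x t)%:E /\ c * expR (F * t) <= x t <= C * expR (F * t).
  exists (fun t => fine (E t)) => t t0; have /andP[h1 h2] := hE _ t0.
  have fE : E t \is a fin_num.
    by rewrite fin_numElt (lt_le_trans (ltNyr _) h1) (le_lt_trans h2 (ltry _)).
  by rewrite fineK//; split => //; rewrite -2!lee_fin fineK// h1.
have lE t : 0 < t -> ((t^-1)%:E * lne (E t))%E = (t^-1 * ln (x t))%:E.
  move=> t0; have [-> /andP[h _]] := xE t t0.
  by rewrite lne_EFin// (lt_le_trans (pos _ _ c0) h).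
apply: cvg_EFin.
  by near=> t; rewrite lE//; near: t; apply: nbhs_pinfty_gt; exact: num_real.
apply/cvgrPdist_le => e e0; have up : F < F + e by rewrite ltrDl.
have dn : F - e < F by rewrite ltrBlDr ltrDl.
near=> t.
have [t0 hu] : 0 < t /\ t^-1 * ln (C * expR (t * F)) <= F + e.
  by near: t; exact: near_log_le.
have [_ hd] : 0 < t /\ F - e <= t^-1 * ln (c * expR (t * F)).
  by near: t; exact: near_log_ge.
rewrite /= lE//=; have [_ /andP[h1 h2]] := xE t t0.
have x0 : 0 < x t by apply: lt_le_trans (pos _ _ c0) h1.
have h3 : t^-1 * ln (x t) <= t^-1 * ln (C * expR (t * F)).
  by rewrite ler_pM2l ?invr_gt0// ler_ln ?posrE// mulrC [t * F]mulrC mulrC ?pos.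
have h4 : t^-1 * ln (c * expR (t * F)) <= t^-1 * ln (x t).
  by rewrite ler_pM2l ?invr_gt0// [t * F]mulrC ler_ln ?posrE// pos.
rewrite ler_norml; apply/andP; split; lra.
Unshelve. all: by end_near.
Qed.

Lemma perron_largest_eigenvalue (d : nat) (V : {fset 'rV[int]_d})
    (lambda kappa gamma : R) p (pi : V -> V -> R) alpha rho l r :
  metzler (fk_kernel gamma pi (psi lambda kappa p alpha)) ->
  perron_triple (fk_kernel gamma pi (psi lambda kappa p alpha)) rho l r ->
  largest_eigenvalue (Mmatrix lambda kappa gamma p pi alpha) rho.
Proof.
move=> mk pt; have [l0 r0 rE lE lr] := pt.
set k := fk_kernel _ _ _ in mk pt rE lE.
have ME i j : Mmatrix lambda kappa gamma p pi alpha i j = k (enum_val j) (enum_val i).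
  rewrite mxE /k /fk_kernel eq_sym; case: eqVneq => [->|ne].
    by rewrite mul1r addrC.
  by rewrite mul0r addr0 /flip_rate (negbTE ne).
have gK := @enum_rankK V; have fK := @enum_valK V.
have sumE (f : V -> R) (j : 'I_#|{: V}|) :
    \sum_(i < #|{: V}|) f (enum_val i) * k (enum_val j) (enum_val i) =
    \sum_v' k (enum_val j) v' * f v'.
  by rewrite [RHS](reindex_bij _ fK gK); apply: eq_bigr => i _; rewrite mulrC.
split.
  apply/eigenvalueP; exists (\row_i r (enum_val i)).
    apply/rowP => j; rewrite !mxE -rE -sumE; apply: eq_bigr => i _.
    by rewrite mxE ME.
  have [v0 _] := sum1_inhabited lr.
  apply/eqP => /rowP/(_ (enum_rank v0)); rewrite !mxE enum_rankK => h.
  by have := r0 v0; rewrite h ltxx.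
move=> [x y] /eigenvalueP[u uM un0] /=.
have entry j : \sum_i u 0 i * (k (enum_val j) (enum_val i))%:C%C = (x +i* y)%C * u 0 j.
  have /rowP/(_ j) := uM; rewrite !mxE => <-; apply: eq_bigr => i _.
  by rewrite mxE ME.
have ReD : {morph @complex.Re R : a b / a + b} by move=> [? ?] [? ?].
have ImD : {morph @complex.Im R : a b / a + b} by move=> [? ?] [? ?].
apply: (@perron_spectral_bound _ _ k rho l r (fun v => complex.Re (u 0 (enum_rank v)))
  (fun v => complex.Im (u 0 (enum_rank v))) x y mk pt).
- move=> v; have := congr1 (@complex.Re R) (entry (enum_rank v)).
  rewrite (big_morph _ ReD (erefl _)) enum_rankK.
  rewrite (reindex_bij _ fK gK) => h.
  rewrite (_ : x * _ - y * _ = complex.Re ((x +i* y)%C * u 0 (enum_rank v))); last first.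
    by case: (u 0 _).
  rewrite -h; apply: eq_bigr => i _; rewrite fK; case: (u 0 i) => a b /=; ring.
- move=> v; have := congr1 (@complex.Im R) (entry (enum_rank v)).
  rewrite (big_morph _ ImD (erefl _)) enum_rankK.
  rewrite (reindex_bij _ fK gK) => h.
  rewrite (_ : x * _ + y * _ = complex.Im ((x +i* y)%C * u 0 (enum_rank v))); last first.
    by case: (u 0 _).
  rewrite -h; apply: eq_bigr => i _; rewrite fK; case: (u 0 i) => a b /=; ring.
- apply: contrapT => /forallNP h; case/eqP: un0; apply/rowP => j; rewrite mxE.
  have := h (enum_val j); rewrite fK => /negP; rewrite negb_or !negbK => /andP[/eqP re /eqP im].
  by move: re im; case: (u 0 j) => a b /= -> ->.
Qed.

End Assembly.

Theorem theorem4p1 (R : realType) (d : nat) (hd : (0 < d)%N)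
  (V : {fset 'rV[int]_d}) (hV : V != fset0)
  (lambda kappa gamma : R)
  (hlambda : 0 <= lambda) (hkappa : 0 <= kappa) (hgamma : 0 < gamma)
  (p : 'rV[int]_d -> R) (hp : prob_mass p)
  (hpsym : forall z, p z = p (- z))
  (hpexp : forall alpha : 'rV[R]_d,
    (\esum_(z in [set: 'rV[int]_d])
       (expR (dot alpha (real_vec z)) * p z)%:E < +oo)%E)
  (pi : V -> V -> R) (hpi : forall v v', 0 <= pi v v')
  (hirr : irreducible_rates pi)
  (dO : measure_display) (Omega : measurableType dO) (P : probability Omega R)
  (X : R -> Omega -> 'rV[int]_d) (v : R -> Omega -> V)
  (hXv : markov_process_with_generator P (fun t w => (X t w, v t w))
           (generatorL lambda kappa gamma p pi))
  (hX0 : (P [set w | X 0%R w = 0%R] = 1)%E) :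
  exists F : 'rV[R]_d -> R,
    (forall alpha : 'rV[R]_d,
      [/\ ((t^-1)%:E * lne ('E_P[fun w => expR (dot alpha (real_vec (X t w)))]))%E
            @[t --> +oo] --> (F alpha)%:E,
          largest_eigenvalue (Mmatrix lambda kappa gamma p pi alpha) (F alpha),
          ((F alpha)%:E =
             ereal_sup [set ((\sum_(u : V) psi lambda kappa p alpha u * mu u)%R%:E
                             - gamma%:E * DV_rate pi mu)%E
                       | mu in prob_measures])%E
          /\ ((F alpha)%:E =
             (kappa * Gamma p alpha)%:E +
             ereal_sup [set ((\sum_(u : V)
                                lambda * (expR (dot alpha (real_vec (val u))) - 1)
                                * mu u)%R%:E
                             - gamma%:E * DV_rate pi mu)%E
                       | mu in prob_measures])%E
        & (forall u u' : V, pi u u' = pi u' u) ->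
          (F alpha)%:E =
             ereal_sup [set (\sum_(u : V) psi lambda kappa p alpha u * mu u
                             + gamma * \sum_(u : V) \sum_(u' : V)
                                 Num.sqrt (mu u) * Num.sqrt (mu u')
                                 * flip_rate pi u u')%:E
                       | mu in prob_measures]])
    /\ LDP P (fun t w => t^-1 *: real_vec (X t w)) (legendre F).
Proof.
have [x0 x0V] := fset0Pn _ hV; pose v0 : V := [` x0V]%fset.
have ptE alpha : exists Flr : R * (V -> R) * (V -> R),
    perron_triple (fk_kernel gamma pi (psi lambda kappa p alpha)) Flr.1.1 Flr.1.2 Flr.2.
  have [rho [l [r h]]] := perron_frobenius v0
    (fk_kernel_metzler (psi lambda kappa p alpha) hgamma hpi hirr).
  by exists (rho, l, r).
have [Flr hFlr] := choice ptE.
pose F a := (Flr a).1.1; pose l a := (Flr a).1.2; pose r a := (Flr a).2.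
have pt a : perron_triple (fk_kernel gamma pi (psi lambda kappa p a)) (F a) (l a) (r a).
  exact: hFlr.
have bE alpha : exists cC : R * R, [/\ 0 < cC.1, 0 < cC.2 & forall t, 0 < t ->
    ((cC.1 * expR (F alpha * t))%:E <= \int[P]_w (expo alpha (X t w))%:E <=
     (cC.2 * expR (F alpha * t))%:E)%E].
  have [_ r0 rE _ _] := pt alpha.
  have [c [C h]] := mgf_bounds hlambda hkappa hgamma hp hpi hpexp hXv hX0 r0 rE.
  by exists (c, C).
have [cC hcC] := choice bE.
exists F; split=> [alpha|].
  split.
  - have [c0 C0 h] := hcC alpha; apply: (log_cvg c0 C0) => t t0.
    by rewrite unlock; exact: h.
  - exact: (perron_largest_eigenvalue
      (fk_kernel_metzler (psi lambda kappa p alpha) hgamma hpi hirr) (pt alpha)).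
  - split; first exact: (perron_DV hgamma hpi hirr (pt alpha)).
    pose phi (u : V) := lambda * (expR (dot alpha (real_vec (val u))) - 1).
    have pt' : perron_triple (fk_kernel gamma pi phi) (F alpha - kappa * Gamma p alpha)
        (l alpha) (r alpha).
      have kE u u' : fk_kernel gamma pi phi u u' =
          fk_kernel gamma pi (psi lambda kappa p alpha) u u' -
          (u == u')%:R * (kappa * Gamma p alpha).
        by rewrite /fk_kernel /phi /psi; ring.
      have [l0 r0 rE lE lr] := pt alpha; split=> // u.
      + under eq_bigr do rewrite kE mulrBl; rewrite sumrB rE mulrBl; congr (_ - _).
        rewrite (bigD1 u)//= eqxx mul1r big1 ?addr0// => u' /negbTE u'u.
        by rewrite eq_sym u'u !mul0r.
      + under eq_bigr do rewrite kE mulrBr; rewrite sumrB lE mulrBl; congr (_ - _).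
        rewrite (bigD1 u)//= eqxx mul1r big1 ?addr0 1?mulrC// => u' /negbTE u'u.
        by rewrite u'u mul0r mulr0.
    rewrite -(perron_DV hgamma hpi hirr pt') -EFinD; congr (_%:E); ring.
  - by move=> sym; exact: (perron_rayleigh hgamma hpi hirr sym (pt alpha)).
have mZ t : 0 < t -> forall A : set 'rV[R]_d,
    measurable ((fun w => t^-1 *: real_vec (X t w)) @^-1` A).
  move=> t0 A; exact: (process_discrete hXv (ltW t0)
    [set y | A (t^-1 *: real_vec y.1)]).
have mgf a t : 0 < t ->
    (((cC a).1 * expR (F a * t))%:E <=
       \int[P]_w (expR (t * dot a (t^-1 *: real_vec (X t w))))%:E <=
     ((cC a).2 * expR (F a * t))%:E)%E.
  move=> t0; have [_ _ h] := hcC a.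
  rewrite (eq_integral (fun w => (expo a (X t w))%:E)); first exact: h.
  by move=> w _; rewrite dotZr mulrA mulfV ?gt_eqF// mul1r.
have c0 a : 0 < (cC a).1 by have [] := hcC a.
have C0 a : 0 < (cC a).2 by have [] := hcC a.
have Fquad a : exists g, quad_expansion F a g.
  exact: (root_quad_expansion hgamma hp hpi hirr hpexp a pt).
split=> [B cB|G oG].
- exact: (ldp_upper mZ C0 mgf cB).
- exact: (ldp_lower mZ c0 C0 mgf Fquad oG).
Qed.
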